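(* Let $\beta>1$ and $\mathbf{L}\in Q^2(\mathbb{D}^2)$. An analytic function $F\colon\mathbb{D}^2\to\mathbb{C}$ has bounded $\mathbf{L}$-index in joint variables if and only if there exist $c\in(0,+\infty)$ and $N\in\mathbb{N}$ such that for each $z\in\mathbb{D}^2$ $$\sum_{0\le k_1+k_2\le N}\frac{|F^{(k_1,k_2)}(z)|}{k_1!k_2!\,l_1^{k_1}(z)l_2^{k_2}(z)}\ge c\sum_{k_1+k_2\ge N+1}\frac{|F^{(k_1,k_2)}(z)|}{k_1!k_2!\,l_1^{k_1}(z)l_2^{k_2}(z)}.$$
   Context: $\mathbb{D}^2=\{(z_1,z_2)\in\mathbb{C}^2:|z_1|<1,|z_2|<1\}$, $\mathbb{Z}_+=\{0,1,2,\dots\}$, $\mathbb{R}_+=[0,\infty)$. $\mathbf{L}(z)=(l_1(z),l_2(z))$, where each $l_j\colon\mathbb{D}^2\to\mathbb{R}_+$ is continuous and satisfies $l_j(z_1,z_2)>\beta/(1-|z_j|)$ for all $(z_1,z_2)\in\mathbb{D}^2$, $j=1,2$. For $z^0\in\mathbb{C}^2$ and $R=(r_1,r_2)\in\mathbb{R}_+^2$: $\mathbb{D}^2[z^0,R]=\{z:|z_j-z_j^0|\le r_j,\ j=1,2\}$ and $\frac{R}{\mathbf{L}(z^0)}=\big(\frac{r_1}{l_1(z^0)},\frac{r_2}{l_2(z^0)}\big)$. $F^{(p,q)}=\frac{\partial^{p+q}F}{\partial z_1^p\partial z_2^q}$. An analytic $F\colon\mathbb{D}^2\to\mathbb{C}$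 has bounded $\mathbf{L}$-index in joint variables if there is $n_0\in\mathbb{Z}_+$ such that for all $z\in\mathbb{D}^2$ and all $(p_1,p_2)\in\mathbb{Z}_+^2$: $\frac{|F^{(p_1,p_2)}(z)|}{p_1!p_2!\,l_1^{p_1}(z)l_2^{p_2}(z)}\le\max\{\frac{|F^{(k_1,k_2)}(z)|}{k_1!k_2!\,l_1^{k_1}(z)l_2^{k_2}(z)}:0\le k_1+k_2\le n_0\}$. $Q^2(\mathbb{D}^2)$ is the class of such $\mathbf{L}$ for which, for all $R=(r_1,r_2)\in[0,\beta]^2$ and $j=1,2$, $0<\lambda_{1,j}(R)\le\lambda_{2,j}(R)<\infty$, where $\lambda_{1,j}(R)=\inf_{z^0\in\mathbb{D}^2}\inf\{l_j(z)/l_j(z^0): z\in\mathbb{D}^2[z^0,R/\mathbf{L}(z^0)]\}$ and $\lambda_{2,j}(R)=\sup_{z^0\in\mathbb{D}^2}\sup\{l_j(z)/l_j(z^0): z\in\mathbb{D}^2[z^0,R/\mathbf{L}(z^0)]\}$. *)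

(* Defs.v *)
From mathcomp Require Import all_boot all_algebra.
From mathcomp Require Import all_classical all_reals all_analysis.
From mathcomp Require Import complex.
Import GRing.Theory Num.Theory.
Import numFieldNormedType.Exports.

Set Implicit Arguments.
Unset Strict Implicit.
Unset Printing Implicit Defensive.

Local Open Scope ring_scope.
Local Open Scope classical_set_scope.

(* The complex field C = R[i], seen as a numClosedFieldType, hence a normed
   module over itself; C * C is then a normed module over C. *)
Definition Cc (R : realType) : numClosedFieldType := R[i].

Section Defs.
Variable R : realType.
Local Notation C := (Cc R).

Definition cmod (w : C) : R := Normc.normc (w : R[i]).

Definition D2 (z : C * C) : Prop := cmod z.1 < 1 /\ cmod z.2 < 1.

(* analytic (holomorphic) on D^2 : complex (C-linear) Frechet differentiable
   at every point of D^2 *)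
Definition analytic_D2 (F : C * C -> C) : Prop :=
  forall z, D2 z -> differentiable F z.

Definition pd1 (F : C * C -> C) : C * C -> C := fun z => 'D_((1 : C), (0 : C)) F z.
Definition pd2 (F : C * C -> C) : C * C -> C := fun z => 'D_((0 : C), (1 : C)) F z.

Definition pderiv (p q : nat) (F : C * C -> C) : C * C -> C :=
  iter p pd1 (iter q pd2 F).

Definition admissible (beta : R) (l1 l2 : C * C -> R) : Prop :=
  forall z, D2 z ->
    {for z, continuous l1} /\ {for z, continuous l2} /\
    0 <= l1 z /\ 0 <= l2 z /\
    beta / (1 - cmod z.1) < l1 z /\ beta / (1 - cmod z.2) < l2 z.

Definition in_polydisc (l1 l2 : C * C -> R) (z0 : C * C) (r1 r2 : R) (z : C * C) : Prop :=
  cmod (z.1 - z0.1) <= r1 / l1 z0 /\ cmod (z.2 - z0.2) <= r2 / l2 z0.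

Definition ratio_set (l1 l2 lj : C * C -> R) (r1 r2 : R) : set (\bar R) :=
  [set x | exists z0 z, D2 z0 /\ D2 z /\ in_polydisc l1 l2 z0 r1 r2 z /\
                        x = ((lj z / lj z0)%:E)].

Definition lambda1 (l1 l2 lj : C * C -> R) (r1 r2 : R) : \bar R :=
  ereal_inf (ratio_set l1 l2 lj r1 r2).
Definition lambda2 (l1 l2 lj : C * C -> R) (r1 r2 : R) : \bar R :=
  ereal_sup (ratio_set l1 l2 lj r1 r2).

Definition lambda_ok (l1 l2 lj : C * C -> R) (r1 r2 : R) : Prop :=
  (0 < lambda1 l1 l2 lj r1 r2)%E /\
  (lambda1 l1 l2 lj r1 r2 <= lambda2 l1 l2 lj r1 r2)%E /\
  (lambda2 l1 l2 lj r1 r2 < +oo)%E.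

Definition Q2 (beta : R) (l1 l2 : C * C -> R) : Prop :=
  admissible beta l1 l2 /\
  forall r1 r2 : R, 0 <= r1 <= beta -> 0 <= r2 <= beta ->
    lambda_ok l1 l2 l1 r1 r2 /\ lambda_ok l1 l2 l2 r1 r2.

Definition nterm (F : C * C -> C) (l1 l2 : C * C -> R) (k1 k2 : nat) (z : C * C) : R :=
  cmod (pderiv k1 k2 F z) /
    ((k1`!)%:R * (k2`!)%:R * l1 z ^+ k1 * l2 z ^+ k2).

Definition bounded_L_index (F : C * C -> C) (l1 l2 : C * C -> R) : Prop :=
  exists n0 : nat, forall z, D2 z -> forall p1 p2 : nat,
    nterm F l1 l2 p1 p2 z <=
      \big[Num.max/0]_(k1 < n0.+1)
         \big[Num.max/0]_(k2 < n0.+1 | (k1 + k2 <= n0)%N) nterm F l1 l2 k1 k2 z.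

End Defs.

(* Main.v *)
Require Import Defs.
From mathcomp Require Import all_boot all_order all_algebra.
From mathcomp Require Import all_classical all_reals all_analysis.
From mathcomp Require Import complex ring lra.
Import Order.TTheory GRing.Theory Num.Theory.
Import numFieldNormedType.Exports.
Local Open Scope ring_scope.
Local Open Scope classical_set_scope.

(** Both conditions say that all normalized derivatives at z are dominated by
    C times the sum G_N(z) of those of order at most N. The hypothesis on L
    makes the weights l_j comparable on the polydisc of radius beta / L(z), so
    there the derivatives of order at most N satisfy a closed system of linear
    differential inequalities along each coordinate direction; Gronwall gives
    |F| <= K G_N(z) on that polydisc, and Cauchy's estimates then yield
    geometric decay beta^-(p1+p2) of the normalized derivatives, relative to
    G_N(z). As beta > 1, the decay gives each condition from the other.

    The Cauchy theory is obtained from mere differentiability: Goursat's lemma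
    applied to g (a + exp z) on rectangles shows that circle means do not
    depend on the radius. Integrals of complex functions are taken
    componentwise, which costs a factor 2 in the estimates. *)

Set Implicit Arguments.
Unset Strict Implicit.
Unset Printing Implicit Defensive.

(** * The modulus on the complex field and complex derivatives *)

#[local] Arguments cmod : simpl never.

Section Modulus.
Variable R : realType.
Local Notation C := (Cc R).
Implicit Types z w : C.

(** The functions [l1], [l2] are only continuous, so normalized derivatives with moving weights
    cannot be differentiated along a line. The weights are therefore frozen at the centre of the
    polydisc. The hypothesis on [L], applied with [r1 = r2 = beta], passes between frozen and actual
    weights at the cost of one factor [B] per order of differentiation; this cost stays bounded
    because the differential system only involves orders up to [N + 1]. The condition
    [l_j > beta / (1 - |z_j|)] says that [beta / l_j] is smaller than the distance to the boundary,
    so Cauchy's estimate may use this full radius.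

    Both implications start from the same domination and differ only at the end. In one, a double
    geometric series bounds the tail. In the other, the decay is followed up to an order [m] at
    which its factor drops below one, and [m] (or [N], if larger) serves as the index. *)

Definition rc (x : R) : C := Complex x 0.

(** The norm of [Cc R] takes values in [Cc R] itself. Estimates are carried out in [R] with [cmod],
    and this identity links the two. *)
Lemma norm_cmod z : `|z| = rc (cmod z).
Proof. by []. Qed.

Lemma rcE (x : R) : rc x = real_complex R x. Proof. by []. Qed.
Lemma rcD x y : rc (x + y) = rc x + rc y. Proof. by rewrite !rcE rmorphD. Qed.
Lemma rcB x y : rc (x - y) = rc x - rc y. Proof. by rewrite !rcE rmorphB. Qed.
Lemma rc0 : rc 0 = 0. Proof. by []. Qed.
Lemma rc1 : rc 1 = 1. Proof. by []. Qed.
Lemma rc_nat n : rc n%:R = n%:R. Proof. by rewrite !rcE rmorph_nat. Qed.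
Lemma rc_lt x y : (rc x < rc y) = (x < y). Proof. exact: ltcR. Qed.
Lemma rc_le x y : (rc x <= rc y) = (x <= y). Proof. exact: lecR. Qed.

Lemma cmod_ge0 z : 0 <= cmod z.
Proof. by rewrite -rc_le -norm_cmod normr_ge0. Qed.
Lemma cmodM z w : cmod (z * w) = cmod z * cmod w. Proof. exact: Normc.normcM. Qed.
Lemma cmodD z w : cmod (z + w) <= cmod z + cmod w. Proof. exact: le_normcD. Qed.
Lemma cmodN z : cmod (- z) = cmod z. Proof. exact: normcN. Qed.
Lemma cmodV z : cmod z^-1 = (cmod z)^-1. Proof. exact: Normc.normcV. Qed.
Lemma cmodB z w : cmod (z - w) <= cmod z + cmod w.
Proof. by rewrite -(cmodN w) cmodD. Qed.
Lemma cmodC z w : cmod (z - w) = cmod (w - z).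
Proof. by rewrite -cmodN opprB. Qed.
Lemma cmod0 : cmod (0 : C) = 0. Proof. exact: Normc.normc0. Qed.
Lemma cmod1 : cmod (1 : C) = 1. Proof. exact: Normc.normc1. Qed.
Lemma cmodX z n : cmod (z ^+ n) = cmod z ^+ n.
Proof. by elim: n => [|n IH]; rewrite ?expr0 ?cmod1// !exprS cmodM IH. Qed.
Lemma cmod_rc x : cmod (rc x) = `|x|.
Proof. by rewrite /cmod /= expr0n /= addr0 sqrtr_sqr. Qed.
Lemma cmod_eq0 z : (cmod z == 0) = (z == 0).
Proof. by apply/eqP/eqP => [/Normc.eq0_normc//|->]; exact: cmod0. Qed.
Lemma cmod_gt0 z : (0 < cmod z) = (z != 0).
Proof. by rewrite lt_def cmod_ge0 andbT cmod_eq0. Qed.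
Lemma cmod_sqr z : cmod z ^+ 2 = complex.Re z ^+ 2 + complex.Im z ^+ 2.
Proof. by case: z => a b; rewrite /cmod /= sqr_sqrtr// addr_ge0 ?sqr_ge0. Qed.
Lemma cRe_le z : `|complex.Re z| <= cmod z.
Proof.
rewrite -(@ler_pXn2r _ 2)// ?nnegrE ?cmod_ge0// cmod_sqr real_normK ?num_real//.
by rewrite lerDl sqr_ge0.
Qed.
Lemma cIm_le z : `|complex.Im z| <= cmod z.
Proof.
rewrite -(@ler_pXn2r _ 2)// ?nnegrE ?cmod_ge0// cmod_sqr real_normK ?num_real//.
by rewrite lerDr sqr_ge0.
Qed.
Lemma cmod_le z : cmod z <= `|complex.Re z| + `|complex.Im z|.
Proof.
rewrite -(@ler_pXn2r _ 2)// ?nnegrE ?cmod_ge0 ?addr_ge0// cmod_sqr.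
rewrite sqrrD !real_normK ?num_real// -addrA lerD2l lerDr.
by rewrite mulrn_wge0// mulr_ge0.
Qed.

Lemma cReD z w : complex.Re (z + w) = complex.Re z + complex.Re w.
Proof. by case: z; case: w. Qed.
Lemma cImD z w : complex.Im (z + w) = complex.Im z + complex.Im w.
Proof. by case: z; case: w. Qed.
Lemma cReN z : complex.Re (- z) = - complex.Re z.
Proof. by case: z. Qed.
Lemma cImN z : complex.Im (- z) = - complex.Im z.
Proof. by case: z. Qed.
Lemma cReM z w : complex.Re (z * w) =
  complex.Re z * complex.Re w - complex.Im z * complex.Im w.
Proof. by case: z; case: w. Qed.
Lemma cImM z w : complex.Im (z * w) =
  complex.Re z * complex.Im w + complex.Im z * complex.Re w.
Proof. by case: z; case: w. Qed.
Lemma Ceq z w : complex.Re z = complex.Re w -> complex.Im z = complex.Im w -> z = w.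
Proof. by case: z; case: w => a b c d /= -> ->. Qed.

(** Complex differentiability with the error multiplied out instead of divided: [h = 0] is harmless
    and every estimate is an inequality between reals. *)
Definition has_cd (f : C -> C) (a d : C) := forall e : R, 0 < e ->
  exists2 dl : R, 0 < dl & forall h, cmod h < dl ->
    cmod (f (a + h) - f a - d * h) <= e * cmod h.

(** In the order on [R[i]], comparability with [0] forces the imaginary part to vanish. *)
Lemma posC (e : C) : 0 < e -> exists2 x : R, 0 < x & e = rc x.
Proof.
case: e => x y; rewrite ltcE /= => /andP[/eqP -> x0]; by exists x.
Qed.

(** Lets sums, products and inverses inherit their derivatives from the library, while the estimates
    below use the epsilon form. *)
Lemma has_cdP (f : C -> C) a d : is_derive a (1 : C) f d <-> has_cd f a d.
Proof.
split=> [[df <-] e e0|H].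
  have /cvgrPdist_le /(_ (rc e)) := df.
  rewrite rc_lt => /(_ e0) /=.
  case/nbhs_ballP => dl /= dl0 Hd.
  have [x x0 dE] := posC dl0; exists x => // h hx.
  have [->|h0] := eqVneq h 0; first by rewrite addr0 mulr0 subrr subr0 cmod0 mulr0.
  have := Hd h; rewrite -ball_normE /ball_ /= sub0r normrN norm_cmod dE rc_lt.
  move=> /(_ hx h0).
  rewrite norm_cmod rc_le.
  have -> : f (a + h) - f a - 'D_1 f a * h =
     - (h * (('D_1 f a) - h^-1 *: (f (h *: 1 + a) - f a))).
    rewrite /GRing.scale /= mulr1 (addrC h) mulrBr mulrA mulfV// mul1r; ring.
  by rewrite cmodN cmodM mulrC => ?; rewrite ler_wpM2r// cmod_ge0.
have D : (fun h : C => h^-1 *: (f (h *: 1 + a) - f a)) @ 0^' --> d.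
  apply/cvgrPdist_le => e /posC[e' e0 ->].
  have [dl dl0 Hd] := H _ e0.
  apply/nbhs_ballP; exists (rc dl) => /=; first by rewrite rc_lt.
  move=> h; rewrite -ball_normE /ball_ /= sub0r normrN norm_cmod rc_lt => hd h0.
  rewrite norm_cmod rc_le.
  have -> : d - h^-1 *: (f (h *: 1 + a) - f a) = - (h^-1 * (f (a + h) - f a - d * h)).
    rewrite /GRing.scale /= mulr1 (addrC h) [in RHS]mulrBr (mulrC d) (mulrA _ h) mulVf//; ring.
  rewrite cmodN cmodM cmodV mulrC ler_pdivrMr ?cmod_gt0//; exact: Hd.
split; first by apply/cvg_ex; exists d.
exact/cvg_lim.
Qed.

End Modulus.

(** * Integrals of complex functions of a real variable *)

Section RealIntegral.
Variable R : realType.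
Implicit Types (f g : R -> R) (a b : R).
Local Notation mu := (@lebesgue_measure R).

Definition cont_on f a b := forall t, a <= t <= b -> {for t, continuous f}.

Lemma real_cont f (t : R) : (forall e : R, 0 < e ->
  exists2 dl : R, 0 < dl & forall s, `|s| < dl -> `|f (t + s) - f t| <= e) ->
  {for t, continuous f}.
Proof.
move=> H; apply/cvgrPdist_le => e e0.
have [dl dl0 Hd] := H e e0; apply/nbhs_ballP; exists dl => //= s.
rewrite /ball_ /= distrC => /Hd. rewrite (addrC t) subrK.
by rewrite distrC.
Qed.

Definition rint a b f : R := \int[mu]_(t in `[a, b]) f t.

Lemma cont_on_within f a b : cont_on f a b -> {within `[a, b], continuous f}.
Proof.
move=> H; apply: continuous_in_subspaceT => t.
by rewrite inE /= in_itv /= => /H.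
Qed.

Lemma cont_on_int f a b : cont_on f a b -> mu.-integrable `[a, b] (EFin \o f).
Proof.
move=> /cont_on_within H; apply: continuous_compact_integrable => //.
exact: segment_compact.
Qed.

Lemma cont_onW f a b c d : a <= c -> d <= b -> cont_on f a b -> cont_on f c d.
Proof.
move=> ac db H t /andP[ct td]; apply: H.
by rewrite (le_trans ac ct) (le_trans td db).
Qed.

Lemma rintD f g a b : cont_on f a b -> cont_on g a b ->
  rint a b (fun t => f t + g t) = rint a b f + rint a b g.
Proof.
move=> cf cg; rewrite /rint RintegralD//; exact: cont_on_int.
Qed.

Lemma rintZ f k a b : cont_on f a b ->
  rint a b (fun t => k * f t) = k * rint a b f.
Proof. move=> cf; rewrite /rint RintegralZl//; exact: cont_on_int. Qed.

Lemma rint_split f a b c : a <= c -> c <= b -> cont_on f a b ->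
  rint a b f = rint a c f + rint c b f.
Proof.
move=> ac cb cf; rewrite /rint.
have := @Rintegral_itvB R f (BLeft a) (BRight b) c (cont_on_int cf).
rewrite !bnd_simp => /(_ ac cb) /eqP; rewrite subr_eq addrC => /eqP ->.
congr (_ + _); rewrite Rintegral_itv_obnd_cbnd//.
apply: (@integrableS _ _ _ mu `[c, b]%classic) => //.
  by apply: subset_itv; rewrite bnd_simp.
by apply: cont_on_int; apply: cont_onW cf.
Qed.

Lemma rint_bound f a b (M : R) : a <= b -> cont_on f a b ->
  (forall t, a <= t <= b -> `|f t| <= M) -> `|rint a b f| <= M * (b - a).
Proof.
move=> ab cf fM; rewrite /rint.
have cn : cont_on (fun t => `|f t|) a b.
  move=> t /cf ct; apply: (continuous_comp ct); exact: norm_continuous.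
apply: (le_trans (le_normr_Rintegral _ _)) => //; first exact: cont_on_int.
have -> : M * (b - a) = \int[mu]_(t in `[a, b]) M.
  rewrite Rintegral_cst//=.
  have -> // : mu `[a, b] = (b - a)%:E.
  rewrite lebesgue_measure_itv /= lte_fin -EFinB.
  by case: ltgtP ab => // -> _; rewrite subrr.
apply: le_Rintegral => //; first exact: cont_on_int.
by apply: cont_on_int => t _; exact: cst_continuous.
Qed.

Lemma rint_ftc F f a b : a < b -> cont_on f a b ->
  (forall t, a <= t <= b -> is_derive t 1 F (f t)) -> rint a b f = F b - F a.
Proof.
move=> ab cf dF; rewrite /rint /Rintegral.
have cF t : a <= t <= b -> {for t, continuous F}.
  by move=> /dF [d _]; apply: differentiable_continuous; exact/derivable1_diffP.
rewrite (@continuous_FTC2 _ f F)//.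
- exact: cont_on_within.
- split.
  + move=> t; rewrite in_itv /= => /andP[at_ tb].
    by have [] : is_derive t 1 F (f t) by apply: dF; rewrite !ltW.
  + by apply: cvg_at_right_filter; apply: cF; rewrite lexx ltW.
  + by apply: cvg_at_left_filter; apply: cF; rewrite lexx ltW.
- move=> t; rewrite in_itv /= => /andP[at_ tb].
  by rewrite derive1E; have [] : is_derive t 1 F (f t) by apply: dF; rewrite !ltW.
Qed.

Lemma rint_ext f g a b : (forall t, f t = g t) -> rint a b f = rint a b g.
Proof. by move=> H; congr rint; apply/funext. Qed.

End RealIntegral.

(** * Complex-valued integrands and curves *)

Section ComplexIntegral.
Variable R : realType.
Local Notation C := (Cc R).
Local Notation Re := (@complex.Re R).
Local Notation Im := (@complex.Im R).
Implicit Types (f g : R -> C) (a b : R).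

Definition ccont f a b := cont_on (Re \o f) a b /\ cont_on (Im \o f) a b.

Definition cint a b f : C := Complex (rint a b (Re \o f)) (rint a b (Im \o f)).

Lemma ccontP f a b : (forall t, a <= t <= b -> forall e : R, 0 < e ->
  exists2 dl : R, 0 < dl & forall s, `|s| < dl -> cmod (f (t + s) - f t) <= e) ->
  ccont f a b.
Proof.
move=> H; split=> t /H Ht; apply: real_cont => e /Ht[dl dl0 Hd]; exists dl => // s /Hd;
    apply: le_trans.
  by have := cRe_le (f (t + s) - f t); rewrite cReD cReN.
by have := cIm_le (f (t + s) - f t); rewrite cImD cImN.
Qed.

Lemma ccontD f g a b : ccont f a b -> ccont g a b -> ccont (fun t => f t + g t) a b.
Proof.
move=> [f1 f2] [g1 g2]; split=> t tab.
  have -> : Re \o (fun t => f t + g t) = (Re \o f) \+ (Re \o g) by apply/funext => s; rewrite /= cReD.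
  by apply: continuousD; [apply: f1|apply: g1].
have -> : Im \o (fun t => f t + g t) = (Im \o f) \+ (Im \o g) by apply/funext => s; rewrite /= cImD.
by apply: continuousD; [apply: f2|apply: g2].
Qed.

Lemma ccontM f g a b : ccont f a b -> ccont g a b -> ccont (fun t => f t * g t) a b.
Proof.
move=> [f1 f2] [g1 g2]; split=> t tab.
  have -> : Re \o (fun t => f t * g t) = ((Re \o f) \* (Re \o g)) \- ((Im \o f) \* (Im \o g)).
    by apply/funext => s; rewrite /= cReM.
  by apply: continuousB; apply: continuousM; [exact: f1|exact: g1|exact: f2|exact: g2].
have -> : Im \o (fun t => f t * g t) = ((Re \o f) \* (Im \o g)) \+ ((Im \o f) \* (Re \o g)).
  by apply/funext => s; rewrite /= cImM.
by apply: continuousD; apply: continuousM; [exact: f1|exact: g2|exact: f2|exact: g1].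
Qed.

Lemma ccont_cst (c : C) a b : ccont (fun=> c) a b.
Proof. by split=> t _; exact: cst_continuous. Qed.

Lemma cintD f g a b : ccont f a b -> ccont g a b ->
  cint a b (fun t => f t + g t) = cint a b f + cint a b g.
Proof.
move=> [f1 f2] [g1 g2]; apply: Ceq; rewrite ?cReD ?cImD /= -rintD//;
by apply: rint_ext => t /=; rewrite ?cReD ?cImD.
Qed.

Lemma cintZ f (k : C) a b : ccont f a b ->
  cint a b (fun t => k * f t) = k * cint a b f.
Proof.
move=> [f1 f2].
have cZ (x : R) (g : R -> R) : cont_on g a b -> cont_on (fun t => x * g t) a b.
  by move=> cg t tab; apply: continuousM; [exact: cst_continuous|exact: cg].
apply: Ceq; rewrite ?cReM ?cImM /= -!rintZ//.
  rewrite -mulN1r -rintZ; last exact: cZ.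
  rewrite -rintD; [|exact: cZ|by apply: (cZ); apply: (cZ)].
  by apply: rint_ext => t /=; rewrite cReM mulN1r.
rewrite -rintD; [|exact: cZ|exact: cZ].
by apply: rint_ext => t /=; rewrite cImM.
Qed.

Lemma cintB f g a b : ccont f a b -> ccont g a b ->
  cint a b (fun t => f t - g t) = cint a b f - cint a b g.
Proof.
move=> cf cg; rewrite -mulN1r -cintZ// -cintD//.
  by congr cint; apply/funext => t; rewrite mulN1r.
by apply: ccontM => //; exact: ccont_cst.
Qed.

Lemma cint_split f a b c : a <= c -> c <= b -> ccont f a b ->
  cint a b f = cint a c f + cint c b f.
Proof.
by move=> ac cb [f1 f2]; apply: Ceq; rewrite ?cReD ?cImD /=; apply: rint_split.
Qed.

Lemma cint_bound f a b (M : R) : a <= b -> ccont f a b ->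
  (forall t, a <= t <= b -> cmod (f t) <= M) -> cmod (cint a b f) <= 2 * M * (b - a).
Proof.
move=> ab [f1 f2] fM; apply: le_trans (cmod_le _) _.
rewrite -mulrA mulr_natl mulr2n; apply: lerD; apply: rint_bound => // t /fM.
  exact: le_trans (cRe_le _).
exact: le_trans (cIm_le _).
Qed.

(** The counterpart of [has_cd] for a curve in [C], with real increments only. *)
Definition has_rd (f : R -> C) (t : R) (d : C) := forall e : R, 0 < e ->
  exists2 dl : R, 0 < dl & forall s : R, `|s| < dl ->
    cmod (f (t + s) - f t - d * rc s) <= e * `|s|.

Lemma is_derive_eps (f : R -> R) t d : (forall e : R, 0 < e ->
  exists2 dl : R, 0 < dl & forall s : R, `|s| < dl ->
    `|f (t + s) - f t - d * s| <= e * `|s|) -> is_derive t 1 f d.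
Proof.
move=> H.
have D : (fun h : R => h^-1 *: (f (h *: 1 + t) - f t)) @ 0^' --> d.
  apply/cvgrPdist_le => e e0.
  have [dl dl0 Hd] := H _ e0.
  apply/nbhs_ballP; exists dl => //= h.
  rewrite -ball_normE /ball_ /= sub0r normrN => hd h0.
  have -> : d - h^-1 *: (f (h *: 1 + t) - f t) = - (h^-1 * (f (t + h) - f t - d * h)).
    rewrite /GRing.scale /= mulr1 (addrC h) [in RHS]mulrBr (mulrC d) (mulrA _ h) mulVf//; ring.
  rewrite normrN normrM normfV mulrC ler_pdivrMr ?normr_gt0//; exact: Hd.
split; first by apply/cvg_ex; exists d.
exact/cvg_lim.
Qed.

Lemma has_rd_Re f t d : has_rd f t d -> is_derive t 1 (Re \o f) (Re d).
Proof.
move=> H; apply: is_derive_eps => e e0; have [dl dl0 Hd] := H e e0.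
exists dl => // s /Hd; apply: le_trans.
by have := cRe_le (f (t + s) - f t - d * rc s); rewrite !(cReD, cReN, cReM) /= mulr0 subr0.
Qed.

Lemma has_rd_Im f t d : has_rd f t d -> is_derive t 1 (Im \o f) (Im d).
Proof.
move=> H; apply: is_derive_eps => e e0; have [dl dl0 Hd] := H e e0.
exists dl => // s /Hd; apply: le_trans.
by have := cIm_le (f (t + s) - f t - d * rc s); rewrite !(cImD, cImN, cImM) /= mulr0 add0r.
Qed.

Lemma cint_ftc F f a b : a < b -> ccont f a b ->
  (forall t, a <= t <= b -> has_rd F t (f t)) -> cint a b f = F b - F a.
Proof.
move=> ab [f1 f2] dF; apply: Ceq; rewrite ?(cReD, cImD, cReN, cImN) /=.
  by apply: (rint_ftc (F := Re \o F)) => // t /dF /has_rd_Re.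
by apply: (rint_ftc (F := Im \o F)) => // t /dF /has_rd_Im.
Qed.

(** A complex curve has no mean value point; the real and imaginary parts each have their own,
    whence the factor 2. *)
Lemma mean_value_ineq F f (M : R) a b : a < b ->
  (forall t, a <= t <= b -> has_rd F t (f t)) ->
  (forall t, a <= t <= b -> cmod (f t) <= M) ->
  cmod (F b - F a) <= 2 * M * (b - a).
Proof.
move=> ab dF fM.
have aux (G g : R -> R) : (forall t, a <= t <= b -> is_derive t 1 G (g t)) ->
    (forall t, a <= t <= b -> `|g t| <= M) -> `|G b - G a| <= M * (b - a).
  move=> dG gM; have [||c] := @MVT R G g a b ab.
  - by move=> x; rewrite in_itv /= => /andP[ax xb]; apply: dG; rewrite !ltW.
  - apply: cont_on_within => t /dG [d _].
    by apply: differentiable_continuous; exact/derivable1_diffP.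
  rewrite in_itv /= => /andP[ac cb] ->.
  have ba : 0 <= b - a by rewrite subr_ge0 ltW.
  by rewrite normrM (ger0_norm ba) ler_wpM2r// gM// !ltW.
apply: le_trans (cmod_le _) _.
rewrite -mulrA mulr_natl mulr2n; apply: lerD.
  rewrite cReD cReN; apply: (aux (Re \o F) (Re \o f)) => t tab.
    exact/has_rd_Re/dF.
  exact: le_trans (cRe_le _) (fM _ tab).
rewrite cImD cImN; apply: (aux (Im \o F) (Im \o f)) => t tab.
  exact/has_rd_Im/dF.
exact: le_trans (cIm_le _) (fM _ tab).
Qed.

End ComplexIntegral.

(** * Differentiation rules and the complex exponential *)

Section Chain.
Variable R : realType.
Local Notation C := (Cc R).
Implicit Types f g : C -> C.

(** The inner increment is abstracted to any [k] close to [c * u], so that one estimate serves both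
    chain rules below: [u] is a complex increment in the first and [rc] of a real one in the
    second. *)
Lemma chain_est f (p d c : C) : has_cd f p d -> forall e : R, 0 < e ->
  exists2 eta : R, 0 < eta & exists2 s : R, 0 < s & forall k u : C,
    cmod (k - c * u) <= eta * cmod u -> cmod u < s ->
    cmod (f (p + k) - f p - d * c * u) <= e * cmod u.
Proof.
move=> fd e e0.
have c1 : 0 < cmod c + 1 by rewrite ltr_wpDl ?cmod_ge0.
have d1 : 0 < cmod d + 1 by rewrite ltr_wpDl ?cmod_ge0.
have e1 : 0 < e / (2 * (cmod c + 1)) by rewrite divr_gt0// mulr_gt0.
have [dl dl0 Hd] := fd _ e1.
(* The bound [1] gives [cmod k <= (cmod c + 1) * cmod u]; the other one makes the term
   [d * (k - c * u)] at most [e / 2 * cmod u]. *)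
exists (Num.min 1 (e / (2 * (cmod d + 1)))).
  by rewrite lt_min ltr01 divr_gt0// mulr_gt0.
exists (dl / (cmod c + 1)); first exact: divr_gt0.
move=> k u ku us.
have [ku1 ku2] : cmod (k - c * u) <= cmod u /\
    cmod (k - c * u) <= e / (2 * (cmod d + 1)) * cmod u.
  split; apply: le_trans ku _; rewrite ?ler_wpM2r ?cmod_ge0 ?ge_min ?lexx ?orbT//.
  by rewrite ler_piMl ?cmod_ge0// ge_min lexx.
have kb : cmod k <= (cmod c + 1) * cmod u.
  have -> : k = (k - c * u) + c * u by rewrite subrK.
  apply: le_trans (cmodD _ _) _; rewrite cmodM mulrDl mul1r addrC lerD2l//.
have kdl : cmod k < dl.
  by apply: le_lt_trans kb _; rewrite mulrC -ltr_pdivlMr.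
have -> : f (p + k) - f p - d * c * u = (f (p + k) - f p - d * k) + d * (k - c * u) by ring.
apply: le_trans (cmodD _ _) _.
have -> : e * cmod u = e / 2 * cmod u + e / 2 * cmod u by field.
apply: lerD.
  apply: le_trans (Hd _ kdl) _.
  have -> : e / 2 * cmod u = e / (2 * (cmod c + 1)) * ((cmod c + 1) * cmod u).
    by field; rewrite gt_eqF.
  by rewrite ler_wpM2l// ltW// divr_gt0// mulr_gt0.
rewrite cmodM.
have -> : e / 2 * cmod u = (cmod d + 1) * (e / (2 * (cmod d + 1)) * cmod u).
  by field; rewrite gt_eqF.
by apply: ler_pM; rewrite ?cmod_ge0 ?lerDl.
Qed.

Lemma has_cd_comp f g a c d : has_cd g a c -> has_cd f (g a) d ->
  has_cd (f \o g) a (d * c).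
Proof.
move=> gc fd e e0; have [eta eta0 [s s0 H]] := chain_est c fd e0.
have [dl dl0 Hd] := gc _ eta0.
exists (Num.min dl s); first by rewrite lt_min dl0.
move=> h; rewrite lt_min => /andP[/Hd h1 hs] /=.
by have := H (g (a + h) - g a) h h1 hs; rewrite (addrC (g a)) subrK.
Qed.

Lemma has_cd_rd f (g : R -> C) t c d : has_rd g t c -> has_cd f (g t) d ->
  has_rd (f \o g) t (d * c).
Proof.
move=> gc fd e e0; have [eta eta0 [s s0 H]] := chain_est c fd e0.
have [dl dl0 Hd] := gc _ eta0.
exists (Num.min dl s); first by rewrite lt_min dl0.
move=> h; rewrite lt_min => /andP[/Hd h1 hs] /=.
have := H (g (t + h) - g t) (rc h); rewrite cmod_rc (addrC (g t)) subrK.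
exact.
Qed.

Lemma has_rd_line (a v : C) t : has_rd (fun s => a + rc s * v) t v.
Proof.
move=> e e0; exists 1 => // s _.
rewrite rcD (_ : _ - _ = 0); last by ring.
by rewrite cmod0 mulr_ge0// ltW.
Qed.

Lemma has_rd_eq (f g : R -> C) t d : (forall s, f s = g s) -> has_rd f t d -> has_rd g t d.
Proof. by move=> /funext <-. Qed.

Lemma has_rd_cont (g : R -> C) t c : has_rd g t c -> forall e : R, 0 < e ->
  exists2 dl : R, 0 < dl & forall s, `|s| < dl -> cmod (g (t + s) - g t) <= e.
Proof.
move=> H e e0; have [dl dl0 Hd] := H 1 ltr01.
have c1 : 0 < cmod c + 1 by rewrite ltr_wpDl ?cmod_ge0.
exists (Num.min dl (e / (cmod c + 1))); first by rewrite lt_min dl0 divr_gt0.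
move=> s; rewrite lt_min => /andP[/Hd h1 h2].
have -> : g (t + s) - g t = (g (t + s) - g t - c * rc s) + c * rc s by rewrite subrK.
apply: le_trans (cmodD _ _) _; rewrite cmodM cmod_rc.
apply: (@le_trans _ _ ((cmod c + 1) * `|s|)).
  by rewrite mulrDl addrC lerD2l.
by rewrite mulrC -ler_pdivlMr// ltW.
Qed.

Lemma has_cd_id a : has_cd (fun z : C => z) a 1.
Proof. by apply/has_cdP; exact: is_derive_id. Qed.
Lemma has_cd_cst (c a : C) : has_cd (fun=> c) a 0.
Proof. by apply/has_cdP; exact: is_derive_cst. Qed.
Lemma has_cdD f g a c d : has_cd f a c -> has_cd g a d ->
  has_cd (fun z => f z + g z) a (c + d).
Proof. by move=> /has_cdP fc /has_cdP gd; apply/has_cdP; exact: is_deriveD. Qed.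
Lemma has_cdB f g a c d : has_cd f a c -> has_cd g a d ->
  has_cd (fun z => f z - g z) a (c - d).
Proof. by move=> /has_cdP fc /has_cdP gd; apply/has_cdP; exact: is_deriveB. Qed.
Lemma has_cdM f g a c d : has_cd f a c -> has_cd g a d ->
  has_cd (fun z => f z * g z) a (f a * d + g a * c).
Proof. by move=> /has_cdP fc /has_cdP gd; apply/has_cdP; exact: is_deriveM. Qed.
Lemma has_cdV f a c : f a != 0 -> has_cd f a c ->
  has_cd (fun z => (f z)^-1) a (- (f a) ^- 2 * c).
Proof.
move=> fa /has_cdP [df fc]; apply/has_cdP; split.
  exact: derivableV.
by rewrite deriveV// fc.
Qed.

End Chain.

(** * The complex exponential, built from the real [expR], [cos] and [sin] *)

Section CExp.
Variable R : realType.
Local Notation C := (Cc R).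
Local Notation Re := (@complex.Re R).
Local Notation Im := (@complex.Im R).

Definition cexp (z : C) : C := Complex (expR (Re z) * cos (Im z)) (expR (Re z) * sin (Im z)).

Lemma cexpD z w : cexp (z + w) = cexp z * cexp w.
Proof.
apply: Ceq; rewrite ?cReM ?cImM /= ?cReD ?cImD expRD ?cosD ?sinD; ring.
Qed.

Lemma cmod_cexp z : cmod (cexp z) = expR (Re z).
Proof.
apply/eqP; rewrite -(@eqrXn2 _ 2)// ?cmod_ge0 ?expR_ge0// cmod_sqr /=.
apply/eqP; rewrite !exprMn -mulrDr cos2Dsin2; ring.
Qed.

Lemma real_deriv_est (f : R -> R) (d : R) : is_derive (0 : R) (1 : R) f d -> forall e : R, 0 < e ->
  exists2 dl : R, 0 < dl & forall h, `|h| < dl -> `|f h - f 0 - d * h| <= e * `|h|.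
Proof.
move=> [df <-] e e0.
have /cvgrPdist_le /(_ e e0) := df => /nbhs_ballP[dl /= dl0 Hd].
exists dl => // h hx.
have [->|h0] := eqVneq h 0; first by rewrite mulr0 subrr subr0 normr0 mulr0.
have := Hd h; rewrite -ball_normE /ball_ /= sub0r normrN => /(_ hx h0).
have -> : f h - f 0 - 'D_1 f 0 * h =
     - (h * (('D_1 f 0) - h^-1 *: (f (h *: 1 + 0) - f 0))).
  rewrite /GRing.scale /= mulr1 addr0 mulrBr mulrA mulfV// mul1r; ring.
by rewrite normrN normrM mulrC => ?; rewrite ler_wpM2r.
Qed.

Lemma cexp_cd0 : has_cd cexp 0 1.
Proof.
move=> e e0.
(* The real and the imaginary part of the error each cost [3 * e' * cmod h]; the bound [e' <= 1]
   absorbs the products of small quantities. *)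
pose e' := Num.min 1 (e / 6).
have e'0 : 0 < e' by rewrite lt_min ltr01 divr_gt0.
have e'1 : e' <= 1 by rewrite ge_min lexx.
have e'e : 6 * e' <= e by rewrite mulrC -ler_pdivlMr// ge_min lexx orbT.
have [d1 d10 H1] := real_deriv_est (is_derive_expR 0) e'0.
have [d2 d20 H2] := real_deriv_est (is_derive_cos 0) e'0.
have [d3 d30 H3] := real_deriv_est (is_derive_sin 0) e'0.
exists (Num.min (Num.min d1 d2) (Num.min d3 (e' / 2))).
  by rewrite !lt_min d10 d20 d30 divr_gt0.
move=> h; rewrite !lt_min => /andP[/andP[h1 h2] /andP[h3 h4]].
have xh := cRe_le h; have yh := cIm_le h.
have := H1 _ (le_lt_trans xh h1); have := H2 _ (le_lt_trans yh h2).
have := H3 _ (le_lt_trans yh h3).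
rewrite expR0 cos0 sin0 oppr0 !mul0r !subr0 !mul1r ?addr0 => sy cy ex.
have hh := cmod_ge0 h.
have C1 := cos_max (Im h).
apply: le_trans (cmod_le _) _.
rewrite add0r !(cReD, cImD, cReN, cImN) /= expR0 cos0 sin0 mulr1 mulr0 subr0.
move: (Re h) (Im h) xh yh C1 sy cy ex => x y xh yh C1 sy cy ex.
move: (cmod h) hh xh yh h1 h2 h3 h4 => m m0 xm ym _ _ _ m2.
have y0 := normr_ge0 y; have x0 := normr_ge0 x.
have ey : e' * `|y| <= e' * m by rewrite ler_pM2l.
have exm : e' * `|x| <= e' * m by rewrite ler_pM2l.
have em : e' * m <= m by rewrite ler_piMl.
have sE : `|sin y| <= 2 * m.
  have -> : sin y = (sin y - y) + y by ring.
  apply: le_trans (ler_normD _ _) _; lra.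
have eE : `|expR x - 1| <= e'.
  have -> : expR x - 1 = (expR x - 1 - x) + x by ring.
  apply: le_trans (ler_normD _ _) _; lra.
have xE : `|1 + x| <= 2.
  by apply: le_trans (ler_normD _ _) _; rewrite normr1; lra.
have A1 : `|expR x * cos y - 1 - x| <= 3 * e' * m.
  have -> : expR x * cos y - 1 - x = (expR x - 1 - x) * cos y + (cos y - 1) * (1 + x) by ring.
  apply: le_trans (ler_normD _ _) _; rewrite !normrM.
  have : `|expR x - 1 - x| * `|cos y| <= e' * m * 1.
    apply: ler_pM => //; apply: le_trans ex _; lra.
  have : `|cos y - 1| * `|1 + x| <= e' * m * 2.
    apply: ler_pM => //; apply: le_trans cy _; lra.
  lra.
have A2 : `|expR x * sin y - y| <= 3 * e' * m.
  have -> : expR x * sin y - y = (expR x - 1) * sin y + (sin y - y) by ring.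
  apply: le_trans (ler_normD _ _) _; rewrite !normrM.
  have : `|expR x - 1| * `|sin y| <= e' * (2 * m) by apply: ler_pM.
  have : `|sin y - y| <= e' * m by apply: le_trans sy _; lra.
  lra.
nra.
Qed.

Lemma cexp0 : cexp 0 = 1.
Proof. by apply: Ceq; rewrite /= expR0 ?cos0 ?sin0 ?mulr1 ?mulr0. Qed.

(** The functional equation carries the derivative at the origin over to [z]. *)
Lemma cexp_cd z : has_cd cexp z (cexp z).
Proof.
move=> e e0.
have z0 : 0 < cmod (cexp z) by rewrite cmod_cexp expR_gt0.
have [dl dl0 Hd] := cexp_cd0 (divr_gt0 e0 z0).
exists dl => // h /Hd; rewrite add0r cexp0 cexpD mul1r => H.
have -> : cexp z * cexp h - cexp z - cexp z * h = cexp z * (cexp h - 1 - h) by ring.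
by rewrite cmodM mulrC -ler_pdivlMr// mulrAC.
Qed.

End CExp.

(** * Goursat's theorem on rectangles *)

Section Goursat.
Variable R : realType.
Local Notation C := (Cc R).
Local Notation Re := (@complex.Re R).
Local Notation Im := (@complex.Im R).
Implicit Types (f g : C -> C) (x y : R).

Definition imag_unit : C := Complex 0 1.

(** The contour integral of [g] over the boundary of the rectangle, counterclockwise: bottom minus
    top, plus right minus left with [dz = i dt]. *)
Definition loop g x0 x1 y0 y1 : C :=
  cint x0 x1 (fun t => g (Complex t y0)) - cint x0 x1 (fun t => g (Complex t y1))
  + imag_unit * (cint y0 y1 (fun t => g (Complex x1 t)) - cint y0 y1 (fun t => g (Complex x0 t))).

#[local] Arguments loop : simpl never.

Definition hol_rect g x0 x1 y0 y1 := forall z : C,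
  x0 <= Re z <= x1 -> y0 <= Im z <= y1 -> exists d, has_cd g z d.

Lemma has_rd_h y t : has_rd (fun s => Complex s y : C) t 1.
Proof.
apply: has_rd_eq (has_rd_line (Complex 0 y) 1 t) => s.
by apply: Ceq; rewrite ?cReD ?cImD ?cReM ?cImM /=; ring.
Qed.

Lemma has_rd_v x t : has_rd (fun s => Complex x s : C) t imag_unit.
Proof.
apply: has_rd_eq (has_rd_line (Complex x 0) imag_unit t) => s.
by apply: Ceq; rewrite ?cReD ?cImD ?cReM ?cImM /=; ring.
Qed.

Lemma hol_ccont_h g x0 x1 y0 y1 y : hol_rect g x0 x1 y0 y1 -> y0 <= y <= y1 ->
  ccont (fun t => g (Complex t y)) x0 x1.
Proof.
move=> H yy; apply: ccontP => t tt.
have [d Hd] := H (Complex t y) tt yy.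
exact: has_rd_cont (has_cd_rd (has_rd_h y t) Hd).
Qed.

Lemma hol_ccont_v g x0 x1 y0 y1 x : hol_rect g x0 x1 y0 y1 -> x0 <= x <= x1 ->
  ccont (fun t => g (Complex x t)) y0 y1.
Proof.
move=> H xx; apply: ccontP => t tt.
have [d Hd] := H (Complex x t) xx tt.
exact: has_rd_cont (has_cd_rd (has_rd_v x t) Hd).
Qed.

Lemma hol_rectW g x0 x1 y0 y1 x0' x1' y0' y1' :
  x0 <= x0' -> x1' <= x1 -> y0 <= y0' -> y1' <= y1 ->
  hol_rect g x0 x1 y0 y1 -> hol_rect g x0' x1' y0' y1'.
Proof.
move=> a b c d H z /andP[h1 h2] /andP[h3 h4]; apply: H.
  by rewrite (le_trans a) ?(le_trans h2).
by rewrite (le_trans c) ?(le_trans h4).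
Qed.

Lemma loop_splitx g x0 x1 y0 y1 x : x0 <= x -> x <= x1 -> y0 <= y1 ->
  hol_rect g x0 x1 y0 y1 ->
  loop g x0 x1 y0 y1 = loop g x0 x y0 y1 + loop g x x1 y0 y1.
Proof.
move=> h0 h1 yy H; rewrite /loop.
rewrite (cint_split h0 h1 (hol_ccont_h H _)) ?lexx//.
rewrite (cint_split h0 h1 (hol_ccont_h H (_ : y0 <= y1 <= y1))) ?lexx ?yy//.
ring.
Qed.

Lemma loop_splity g x0 x1 y0 y1 y : y0 <= y -> y <= y1 -> x0 <= x1 ->
  hol_rect g x0 x1 y0 y1 ->
  loop g x0 x1 y0 y1 = loop g x0 x1 y0 y + loop g x0 x1 y y1.
Proof.
move=> h0 h1 xx H; rewrite /loop.
rewrite (cint_split h0 h1 (hol_ccont_v H (_ : x0 <= x1 <= x1))) ?lexx ?xx//.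
rewrite (cint_split h0 h1 (hol_ccont_v H (_ : x0 <= x0 <= x1))) ?lexx ?xx//.
ring.
Qed.

Lemma cmodD_half (a b : C) (L : R) : L <= cmod (a + b) -> L / 2 <= cmod a \/ L / 2 <= cmod b.
Proof.
move=> H; have := cmodD a b.
case: (lerP (L / 2) (cmod a)) => h1; first by left.
case: (lerP (L / 2) (cmod b)) => h2; first by right.
by lra.
Qed.

(** Cut in [x], then in [y]: each time one of the two halves keeps at least half of the modulus of
    the contour integral, hence the quarter. *)
Lemma bisect g x y (w h : R) : 0 < w -> 0 < h -> hol_rect g x (x + w) y (y + h) ->
  exists p : R * R, [/\ x <= p.1, p.1 + w / 2 <= x + w, y <= p.2, p.2 + h / 2 <= y + h &
   cmod (loop g x (x + w) y (y + h)) / 4 <=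
   cmod (loop g p.1 (p.1 + w / 2) p.2 (p.2 + h / 2))].
Proof.
move=> w0 h0 H.
have y1 : y <= y + h / 2 by lra.
have y2 : y + h / 2 <= y + h by lra.
have yh : y + h / 2 + h / 2 = y + h by field.
have [p1 [a b c]] : exists p1, [/\ x <= p1, p1 + w / 2 <= x + w &
   cmod (loop g x (x + w) y (y + h)) / 2 <= cmod (loop g p1 (p1 + w / 2) y (y + h))].
  have := @loop_splitx g x (x + w) y (y + h) (x + w / 2).
  have -> // : x <= x + w / 2 by lra.
  have -> // : x + w / 2 <= x + w by lra.
  have -> // : y <= y + h by lra.
  move=> /(_ isT isT isT H) E.
  have := lexx (cmod (loop g x (x + w) y (y + h))); rewrite {2}E => /cmodD_half[] h1.
    by exists x; split => //; lra.
  exists (x + w / 2); split; [by lra|by lra|].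
  by have -> : x + w / 2 + w / 2 = x + w by field.
have H1 : hol_rect g p1 (p1 + w / 2) y (y + h) by apply: hol_rectW H.
have := @loop_splity g p1 (p1 + w / 2) y (y + h) (y + h / 2).
have -> // : y <= y + h / 2 by lra.
have -> // : y + h / 2 <= y + h by lra.
have -> // : p1 <= p1 + w / 2 by lra.
move=> /(_ isT isT isT H1) E.
have := lexx (cmod (loop g p1 (p1 + w / 2) y (y + h))); rewrite {2}E => /cmodD_half[] h1.
  exists (p1, y); split; [exact: a|exact: b|exact: lexx|exact: y2|].
  by apply: le_trans h1; clear -c; lra.
exists (p1, y + h / 2); rewrite [_.1]/= [_.2]/= yh; split.
- exact: a.
- exact: b.
- exact: y1.
- exact: lexx.
- by apply: le_trans h1; clear -c; lra.
Qed.

(** Each side contributes a difference of corner values of [F], and these cancel around the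
    rectangle. *)
Lemma loop_primitive F f x0 x1 y0 y1 : x0 < x1 -> y0 < y1 ->
  (forall z, has_cd F z (f z)) -> (forall z, exists d, has_cd f z d) ->
  loop f x0 x1 y0 y1 = 0.
Proof.
move=> xx yy dF df.
have hol : hol_rect f x0 x1 y0 y1 by move=> z _ _; exact: df.
have Hh y : cint x0 x1 (fun t => f (Complex t y)) = F (Complex x1 y) - F (Complex x0 y).
  apply: (@cint_ftc _ (fun t => F (Complex t y))) => //.
    apply: ccontP => t _; have [d Hd] := df (Complex t y).
    exact: has_rd_cont (has_cd_rd (has_rd_h y t) Hd).
  move=> t _; have := has_cd_rd (has_rd_h y t) (dF (Complex t y)).
  by rewrite mulr1.
have Hv x : imag_unit * cint y0 y1 (fun t => f (Complex x t)) = F (Complex x y1) - F (Complex x y0).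
  have cf : ccont (fun t => f (Complex x t)) y0 y1.
    apply: ccontP => t _; have [d Hd] := df (Complex x t).
    exact: has_rd_cont (has_cd_rd (has_rd_v x t) Hd).
  rewrite -cintZ//.
  apply: (@cint_ftc _ (fun t => F (Complex x t))) => //.
    by apply: ccontM => //; exact: ccont_cst.
  move=> t _; have := has_cd_rd (has_rd_v x t) (dF (Complex x t)).
  by rewrite mulrC.
rewrite /loop !Hh mulrBr !Hv; ring.
Qed.

Lemma loopB f g x0 x1 y0 y1 : x0 <= x1 -> y0 <= y1 -> hol_rect f x0 x1 y0 y1 ->
  hol_rect g x0 x1 y0 y1 ->
  loop (fun z => f z - g z) x0 x1 y0 y1 = loop f x0 x1 y0 y1 - loop g x0 x1 y0 y1.
Proof.
move=> xx yy hf hg.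
have y0P : y0 <= y0 <= y1 by rewrite lexx.
have y1P : y0 <= y1 <= y1 by rewrite lexx yy.
have x0P : x0 <= x0 <= x1 by rewrite lexx.
have x1P : x0 <= x1 <= x1 by rewrite lexx xx.
rewrite /loop (cintB (hol_ccont_h hf y0P) (hol_ccont_h hg y0P)).
rewrite (cintB (hol_ccont_h hf y1P) (hol_ccont_h hg y1P)).
rewrite (cintB (hol_ccont_v hf x0P) (hol_ccont_v hg x0P)).
rewrite (cintB (hol_ccont_v hf x1P) (hol_ccont_v hg x1P)).
ring.
Qed.

(** The constant 4 is the factor 2 of [cint_bound] times two opposite sides. *)
Lemma loop_bound g x0 x1 y0 y1 (M : R) : x0 <= x1 -> y0 <= y1 ->
  hol_rect g x0 x1 y0 y1 ->
  (forall z, x0 <= Re z <= x1 -> y0 <= Im z <= y1 -> cmod (g z) <= M) ->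
  cmod (loop g x0 x1 y0 y1) <= 4 * M * ((x1 - x0) + (y1 - y0)).
Proof.
move=> xx yy hg gM.
have y0P : y0 <= y0 <= y1 by rewrite lexx.
have y1P : y0 <= y1 <= y1 by rewrite lexx yy.
have x0P : x0 <= x0 <= x1 by rewrite lexx.
have x1P : x0 <= x1 <= x1 by rewrite lexx xx.
have bh y : y0 <= y <= y1 -> cmod (cint x0 x1 (fun t => g (Complex t y))) <= 2 * M * (x1 - x0).
  by move=> yP; apply: (cint_bound xx (hol_ccont_h hg yP)) => t tt; exact: gM.
have bv x : x0 <= x <= x1 -> cmod (cint y0 y1 (fun t => g (Complex x t))) <= 2 * M * (y1 - y0).
  by move=> xP; apply: (cint_bound yy (hol_ccont_v hg xP)) => t tt; exact: gM.
rewrite /loop; apply: le_trans (cmodD _ _) _; rewrite cmodM.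
have -> : cmod imag_unit = 1 by rewrite /cmod /= expr0n expr1n /= add0r sqrtr1.
rewrite mul1r.
have := cmodB (cint x0 x1 (fun t => g (Complex t y0))) (cint x0 x1 (fun t => g (Complex t y1))).
have := cmodB (cint y0 y1 (fun t => g (Complex x1 t))) (cint y0 y1 (fun t => g (Complex x0 t))).
have := bh _ y0P; have := bh _ y1P; have := bv _ x0P; have := bv _ x1P.
lra.
Qed.

Lemma exists_pow2 (K d : R) : 0 < d -> exists n, K * 2^-1 ^+ n < d.
Proof.
move=> d0; have [n Hn] : exists n : nat, K / d < n%:R.
  exists (Num.bound `|K / d|); apply: le_lt_trans (ler_norm _) _.
  by apply: archi_boundP.
exists n; rewrite exprVn ltr_pdivrMr ?exprn_gt0// mulrC -ltr_pdivrMr//.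
by apply: lt_trans Hn _; rewrite -natrX ltr_nat ltn_expl.
Qed.

(** Bisection produces nested rectangles shrinking to a point [p]. There [g] is affine up to an
    error [e * cmod (z - p)], the affine part integrates to zero, and the error contributes at most
    [e] times diameter times perimeter. This is of the same order [4^-n] as the lower bound that
    bisection gives. *)
Theorem goursat g x0 x1 y0 y1 : x0 < x1 -> y0 < y1 -> hol_rect g x0 x1 y0 y1 ->
  loop g x0 x1 y0 y1 = 0.
Proof.
move=> xx yy hg.
pose w := x1 - x0; pose h := y1 - y0.
have w0 : 0 < w by rewrite subr_gt0.
have h0 : 0 < h by rewrite subr_gt0.
pose q n : R := 2^-1 ^+ n.
have q0 n : 0 < q n by rewrite exprn_gt0// invr_gt0.
have qS n : q n.+1 = q n / 2 by rewrite /q exprSr.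
have q00 : q 0%N = 1 by rewrite /q expr0.
pose ins n (p : R * R) := [/\ x0 <= p.1, p.1 + w * q n <= x1, y0 <= p.2 & p.2 + h * q n <= y1].
pose lp n (p : R * R) := cmod (loop g p.1 (p.1 + w * q n) p.2 (p.2 + h * q n)).
have hins n p : ins n p -> hol_rect g p.1 (p.1 + w * q n) p.2 (p.2 + h * q n).
  by move=> [a b c d]; apply: hol_rectW hg.
(* At stage [n] a rectangle is determined by its lower left corner, its sides being [w * q n] and
   [h * q n]. The premise [ins] sits under the existential so that choice yields a total function of
   stage and corner. *)
have /choice [nxt Hn] : forall np : nat * (R * R), exists p' : R * R, ins np.1 np.2 ->
    [/\ ins np.1.+1 p', np.2.1 <= p'.1, p'.1 + w * q np.1.+1 <= np.2.1 + w * q np.1,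
      (np.2.2 <= p'.2) && (p'.2 + h * q np.1.+1 <= np.2.2 + h * q np.1) &
      lp np.1 np.2 / 4 <= lp np.1.+1 p'].
  move=> [n p] /=; have [|nip] := EM (ins n p); last by exists p.
  move=> ip; have [] := bisect (mulr_gt0 w0 (q0 n)) (mulr_gt0 h0 (q0 n)) (hins _ _ ip).
  move=> p' [a b c d e]; exists p' => _; rewrite /lp qS !mulrA; split => //.
  - case: ip => i1 i2 i3 i4; rewrite /ins qS !mulrA; split => //.
    + exact: le_trans i1 a.
    + exact: le_trans b i2.
    + exact: le_trans i3 c.
    + exact: le_trans d i4.
  - by rewrite c.
pose s := fix s n := if n is m.+1 then nxt (m, s m) else (x0, y0).
have s0 : ins 0%N (s 0%N).
  by rewrite /ins /= /q expr0 !mulr1 /w /h; split; rewrite ?lexx// addrC subrK.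
have si n : ins n (s n).
  by elim: n => // n IH; have [] := Hn (n, s n) IH.
have sS n := Hn (n, s n) (si n).
have lps n : lp 0%N (s 0%N) * q n ^+ 2 <= lp n (s n).
  elim: n => [|n IH]; first by rewrite q00 expr1n mulr1.
  have [_ _ _ _ /=] := sS n; apply: le_trans.
  rewrite qS; move: IH; lra.
have mono n m : (n <= m)%N -> [/\ (s n).1 <= (s m).1, (s m).1 + w * q m <= (s n).1 + w * q n,
    (s n).2 <= (s m).2 & (s m).2 + h * q m <= (s n).2 + h * q n].
  elim: m => [|m IH]; first by rewrite leqn0 => /eqP ->.
  rewrite leq_eqVlt => /orP[/eqP <- //|]; rewrite ltnS => /IH[a b c d].
  have [_ a' b' /andP[c' d'] _] := sS m.
  split; [exact: le_trans a a'|exact: le_trans b' b|exact: le_trans c c'|exact: le_trans d' d].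
(* Nested intervals: the supremum of the left ends lies in all of them. *)
have lims (u v : nat -> R) : (forall n m, (n <= m)%N -> u n <= u m /\ v m <= v n) ->
    (forall n, u n <= v n) -> exists l, forall n, u n <= l <= v n.
  move=> uv uv'; have uvb n m : u n <= v m.
    case/orP: (leq_total n m) => nm.
      exact: le_trans (uv _ _ nm).1 (uv' _).
    exact: le_trans (uv' _) (uv _ _ nm).2.
  have hs : has_sup (range u).
    by split; [exists (u 0%N); exists 0%N|exists (v 0%N) => _ [k _ <-]].
  exists (sup (range u)) => n; apply/andP; split.
    by apply: sup_upper_bound => //; exists n.
  by apply: ge_sup; [exists (u 0%N); exists 0%N|move=> _ [k _ <-]].
have [px Hpx] : exists l, forall n, (s n).1 <= l <= (s n).1 + w * q n.
  apply: lims => [n m /mono[]//|n]; by rewrite lerDl mulr_ge0// ltW.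
have [py Hpy] : exists l, forall n, (s n).2 <= l <= (s n).2 + h * q n.
  apply: lims => [n m /mono[]//|n]; by rewrite lerDl mulr_ge0// ltW.
pose p : C := Complex px py.
have [d Hd] : exists d, has_cd g p d.
  apply: hg => /=; first by have := Hpx 0%N; rewrite /= /q expr0 mulr1 /w addrC subrK.
  by have := Hpy 0%N; rewrite /= /q expr0 mulr1 /h addrC subrK.
(* The factor [q n ^ 2] occurs in the lower bound [lps] and in the upper bound, and cancels. *)
have key (e : R) : 0 < e -> lp 0%N (s 0%N) <= 4 * (w + h) ^+ 2 * e.
  move=> e0; have [dl dl0 He] := Hd e e0.
  have [n Hq] := exists_pow2 (w + h) dl0.
  have qn := q0 n.
  suff : lp n (s n) <= 4 * (w + h) ^+ 2 * e * q n ^+ 2.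
    by move=> /(le_trans (lps n)); rewrite ler_pM2r// exprn_gt0.
  have [xn yn] : (s n).1 <= (s n).1 + w * q n /\ (s n).2 <= (s n).2 + h * q n.
    by rewrite !lerDl !mulr_ge0// ltW.
  have [xn' yn'] : (s n).1 < (s n).1 + w * q n /\ (s n).2 < (s n).2 + h * q n.
    by rewrite !ltrDl !mulr_gt0//.
  (* [a] is the tangent map of [g] at [p] and [Fa] a primitive of it, so subtracting [a] does not
     change the contour integral. *)
  pose a (z : C) := g p + d * (z - p).
  pose Fa (z : C) := g p * z + d * ((z - p) * (z - p)) / 2.
  have ha z : has_cd a z d.
    have := has_cdD (has_cd_cst (g p) z) (has_cdM (has_cd_cst d z) (has_cdB (has_cd_id z) (has_cd_cst p z))).
    by rewrite subr0 mulr1 mulr0 addr0 add0r.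
  have hF z : has_cd Fa z (a z).
    have zp := has_cdB (has_cd_id z) (has_cd_cst p z).
    have := has_cdD (has_cdM (has_cd_cst (g p) z) (has_cd_id z))
      (has_cdM (has_cdM (has_cd_cst d z) (has_cdM zp zp)) (has_cd_cst (2^-1) z)).
    by congr has_cd; rewrite /a; field.
  have hola x1' y1' x2' y2' : hol_rect a x1' x2' y1' y2' by move=> z _ _; exists d.
  have := loopB xn yn (hins _ _ (si n)) (hola _ _ _ _).
  rewrite (loop_primitive xn' yn' hF) ?subr0 /lp; last by move=> z; exists d.
  move=> <-.
  have -> : 4 * (w + h) ^+ 2 * e * q n ^+ 2 = 4 * (e * ((w + h) * q n)) *
     (((s n).1 + w * q n - (s n).1) + ((s n).2 + h * q n - (s n).2)) by ring.
  apply: loop_bound => //.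
    move=> z zx zy; have [c Hc] := hins _ _ (si n) z zx zy.
    by exists (c - d); apply: has_cdB.
  move=> z zx zy.
  have zp : cmod (z - p) <= (w + h) * q n.
    apply: le_trans (cmod_le _) _; rewrite cReD cImD cReN cImN /=.
    have := Hpx n; have := Hpy n; move: zx zy.
    move=> /andP[a1 a2] /andP[a3 a4] /andP[a5 a6] /andP[a7 a8].
    rewrite mulrDl; apply: lerD; rewrite ler_norml; apply/andP; clear -a1 a2 a3 a4 a5 a6 a7 a8;
      split; lra.
  have := He (z - p) (le_lt_trans zp Hq).
  rewrite (addrC p) subrK /a opprD addrA => /le_trans; apply.
  by rewrite ler_wpM2l// ltW.
have lp0 : lp 0%N (s 0%N) = cmod (loop g x0 x1 y0 y1).
  by rewrite /lp /= /q expr0 !mulr1 /w /h (addrC x0) (addrC y0) !subrK.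
apply/eqP; rewrite -cmod_eq0 -lp0 eq_le {2}lp0 cmod_ge0 andbT.
apply/ler_addgt0Pr => e e0; rewrite add0r.
have K0 : 0 < 4 * (w + h) ^+ 2 by rewrite mulr_gt0// exprn_gt0// addr_gt0.
have := key (e / (4 * (w + h) ^+ 2)) (divr_gt0 e0 K0).
by rewrite mulrC divfK// gt_eqF.
Qed.

End Goursat.

(** * Mean value property and first-order Cauchy estimate *)

Section CircleMean.
Variable R : realType.
Local Notation C := (Cc R).
Local Notation Re := (@complex.Re R).
Local Notation Im := (@complex.Im R).
Implicit Types (f g : C -> C) (a z : C) (r : R).

Definition cis (t : R) : C := cexp (Complex 0 t).
Definition two_pi : R := pi *+ 2.

Lemma two_pi_gt0 : 0 < two_pi. Proof. by rewrite /two_pi mulrn_wgt0// pi_gt0. Qed.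

Lemma cexp_polar x t : cexp (Complex x t) = rc (expR x) * cis t.
Proof.
by apply: Ceq; rewrite ?cReM ?cImM /= expR0; ring.
Qed.

Lemma cmod_cis t : cmod (cis t) = 1.
Proof. by rewrite cmod_cexp expR0. Qed.

Lemma cmod_rcis r t : 0 <= r -> cmod (rc r * cis t) = r.
Proof. by move=> r0; rewrite cmodM cmod_cis mulr1 cmod_rc ger0_norm. Qed.

Lemma rcis_neq0 r t : 0 < r -> rc r * cis t != 0.
Proof. by move=> r0; rewrite -cmod_gt0 cmod_rcis// ltW. Qed.

Lemma cmod_circ a r t : 0 <= r -> cmod (a + rc r * cis t - a) = r.
Proof. by move=> r0; rewrite addrC addKr cmod_rcis. Qed.

Lemma has_rd_rcis r t : has_rd (fun s => rc r * cis s) t (@imag_unit R * (rc r * cis t)).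
Proof.
have h1 := has_cd_rd (has_rd_v 0 t) (cexp_cd (Complex 0 t)).
have h2 := has_cdM (has_cd_cst (rc r) (cis t)) (has_cd_id (cis t)).
have := has_cd_rd (g := fun s => cis s) h1 h2.
rewrite mulr0 addr0 mulr1 => h.
have -> : @imag_unit R * (rc r * cis t) = rc r * (cexp (0 +i* t)%C * @imag_unit R) by rewrite /cis; ring.
exact: h.
Qed.

Lemma has_rd_circ a r t : has_rd (fun s => a + rc r * cis s) t (@imag_unit R * (rc r * cis t)).
Proof.
have h := has_cdD (has_cd_cst a (rc r * cis t)) (has_cd_id (rc r * cis t)).
by have := has_cd_rd (has_rd_rcis r t) h; rewrite add0r mul1r.
Qed.

Definition circle_int (f : R -> C) := cint 0 two_pi f.

Lemma ccont_circ g a r : (forall t, exists d, has_cd g (a + rc r * cis t) d) ->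
  ccont (fun t => g (a + rc r * cis t)) 0 two_pi.
Proof.
move=> H; apply: ccontP => t _; have [d Hd] := H t.
exact: has_rd_cont (has_cd_rd (has_rd_circ a r t) Hd).
Qed.

Lemma circle_int_cst (c : C) : circle_int (fun=> c) = rc two_pi * c.
Proof.
rewrite /circle_int (@cint_ftc _ (fun t => 0 + rc t * c) _ _ _ two_pi_gt0 (ccont_cst _ _ _)).
  by rewrite rc0 mul0r !add0r subr0.
by move=> t _; exact: has_rd_line.
Qed.

Lemma rc_two_pi_neq0 : rc two_pi != 0.
Proof. by rewrite -cmod_gt0 cmod_rc ger0_norm ?two_pi_gt0// ltW// two_pi_gt0. Qed.

Lemma cexp_period x : cexp (Complex x two_pi) = cexp (Complex x 0).
Proof. by apply: Ceq; rewrite /= /two_pi ?cos2pi ?sin2pi ?cos0 ?sin0. Qed.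

(** The point [a] is excluded and only a limit [g0] there is assumed, so that difference quotients
    centred at [a] are covered. Constancy in the radius allows comparison with [g0] on an
    arbitrarily small circle. *)
Lemma circle_mean g a (rho : R) (g0 : C) :
  (forall z, 0 < cmod (z - a) < rho -> exists d, has_cd g z d) ->
  (forall e : R, 0 < e -> exists2 dl : R, 0 < dl &
     forall z, 0 < cmod (z - a) < dl -> cmod (g z - g0) <= e) ->
  forall r, 0 < r < rho -> circle_int (fun t => g (a + rc r * cis t)) = rc two_pi * g0.
Proof.
move=> hg lg r /andP[r0 rrho].
pose V s := circle_int (fun t => g (a + rc s * cis t)).
have hV s : 0 < s -> s < rho -> ccont (fun t => g (a + rc s * cis t)) 0 two_pi.
  by move=> s0 sr; apply: ccont_circ => t; apply: hg; rewrite cmod_circ ?ltW// s0.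
have Vconst s : 0 < s -> s < r -> V s = V r.
  move=> s0 sr.
  pose G (z : C) := g (a + cexp z).
  have hG : hol_rect G (ln s) (ln r) 0 two_pi.
    move=> z /andP[_ zr] _.
    have [|d Hd] := hg (a + cexp z).
      rewrite addrC addKr cmod_cexp expR_gt0 /=; apply: le_lt_trans rrho.
      by rewrite -ler_ln ?posrE ?expR_gt0// expRK.
    exists (d * (0 + cexp z)); apply: (@has_cd_comp _ g (fun z => a + cexp z)) => //.
    by apply: has_cdD; [exact: has_cd_cst|exact: cexp_cd].
  have lnsr : ln s < ln r by rewrite ltr_ln ?posrE.
  have := goursat lnsr two_pi_gt0 hG; rewrite /loop.
  (* By periodicity of the exponential the horizontal sides cancel; what remains is the difference
     of the integrals over the circles of radii [r] and [s]. *)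
  have -> : (fun t : R => G (Complex t two_pi)) = (fun t : R => G (Complex t 0)).
    by apply/funext => t; rewrite /G cexp_period.
  have GV u : 0 < u -> cint 0 two_pi (fun t => G (Complex (ln u) t)) = V u.
    by move=> u0; rewrite /V /circle_int; congr cint; apply/funext => t; rewrite /G cexp_polar lnK.
  rewrite subrr add0r !GV// => /eqP; rewrite mulf_eq0 => /orP[|].
    by rewrite -cmod_eq0 /cmod /= expr0n expr1n /= add0r sqrtr1 oner_eq0.
  by rewrite subr_eq0 => /eqP.
apply/eqP; rewrite -subr_eq0 -cmod_eq0 eq_le cmod_ge0 andbT.
apply/ler_addgt0Pr => e e0; rewrite add0r.
have T0 := two_pi_gt0.
have [dl dl0 Hd] := lg (e / (2 * two_pi)) (divr_gt0 e0 (mulr_gt0 (ltr0Sn _ 1) T0)).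
pose s := Num.min r dl / 2.
have mn0 : 0 < Num.min r dl by rewrite lt_min r0.
have [mr md] : Num.min r dl <= r /\ Num.min r dl <= dl by rewrite !ge_min !lexx orbT.
have s0 : 0 < s by rewrite /s divr_gt0.
have sr : s < r by rewrite /s; lra.
have sd : s < dl by rewrite /s; lra.
have -> : circle_int (fun t => g (a + rc r * cis t)) - rc two_pi * g0 =
    cint 0 two_pi (fun t => g (a + rc s * cis t) - g0).
  rewrite -/(V r) -(Vconst s s0 sr) -circle_int_cst /V /circle_int cintB//.
    by apply: hV => //; exact: lt_trans rrho.
  exact: ccont_cst.
have := @cint_bound _ (fun t => g (a + rc s * cis t) - g0) 0 two_pi (e / (2 * two_pi)) (ltW T0).
have FE (T : R) : 0 < T -> 2 * (e / (2 * T)) * (T - 0) = e.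
  by move=> TP; field; rewrite gt_eqF.
rewrite (FE _ T0).
apply.
  have h := ccontM (ccont_cst (-1) 0 two_pi) (ccont_cst g0 0 two_pi).
  have := ccontD (hV s s0 (lt_trans sr rrho)) h.
  by congr ccont; apply/funext => t; rewrite mulN1r.
by move=> t _; apply: Hd; rewrite cmod_circ ?s0// ltW.
Qed.

Definition dC f z : C := 'D_(1 : C) f z.

Lemma has_cd_dC f z d : has_cd f z d -> dC f z = d.
Proof. by move=> /has_cdP [_ <-]. Qed.

Lemma dC_has_cd f z d : has_cd f z d -> has_cd f z (dC f z).
Proof. by move=> h; rewrite (has_cd_dC h). Qed.

Definition hol f a (rho : R) := forall z, cmod (z - a) < rho -> has_cd f z (dC f z).

Lemma holW f a b (rho s : R) : cmod (b - a) + s <= rho -> hol f a rho -> hol f b s.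
Proof.
move=> bs H z zb; apply: H; have -> : z - a = (b - a) + (z - b) by ring.
by apply: le_lt_trans (cmodD _ _) _; apply: lt_le_trans bs; rewrite ltrD2l.
Qed.

Lemma has_cd_cont f a d : has_cd f a d -> forall e : R, 0 < e ->
  exists2 dl : R, 0 < dl & forall z, cmod (z - a) < dl -> cmod (f z - f a) <= e.
Proof.
move=> H e e0; have [dl dl0 Hd] := H 1 ltr01.
have c1 : 0 < cmod d + 1 by rewrite ltr_wpDl ?cmod_ge0.
exists (Num.min dl (e / (cmod d + 1))); first by rewrite lt_min dl0 divr_gt0.
move=> z; rewrite lt_min => /andP[/Hd]; rewrite (addrC a) subrK => h1 h2.
have -> : f z - f a = (f z - f a - d * (z - a)) + d * (z - a) by rewrite subrK.
apply: le_trans (cmodD _ _) _; rewrite cmodM.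
apply: (@le_trans _ _ ((cmod d + 1) * cmod (z - a))).
  by rewrite mulrDl addrC lerD2l.
by rewrite mulrC -ler_pdivlMr// ltW.
Qed.

Lemma hol_center f a (rho : R) : 0 < rho -> hol f a rho -> has_cd f a (dC f a).
Proof. by move=> r0; apply; rewrite subrr cmod0. Qed.

(** [circle_mean] for [(f z - f a) / (z - a)], whose limit at [a] is the derivative. This is
    Cauchy's formula for [f'] with a constant subtracted. *)
Lemma cauchy_quot f a rho r : hol f a rho -> 0 < r < rho ->
  circle_int (fun t => (f (a + rc r * cis t) - f a) / (rc r * cis t)) = rc two_pi * dC f a.
Proof.
move=> hf rr; have /andP[r0 rrho] := rr.
have rho0 := lt_trans r0 rrho.
rewrite -(@circle_mean (fun z => (f z - f a) / (z - a)) a rho (dC f a) _ _ r rr).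
- by rewrite /circle_int; congr cint; apply/funext => t; rewrite (_ : a + _ - a = rc r * cis t)//; ring.
- move=> z /andP[za zr].
  have za' : z - a != 0 by rewrite -cmod_gt0.
  have h1 := has_cdB (hf _ zr) (has_cd_cst (f a) z).
  have h2 := @has_cdV R (fun z => z - a) z _ za' (has_cdB (has_cd_id z) (has_cd_cst a z)).
  by eexists; apply: has_cdM h1 h2.
- move=> e e0; have [dl dl0 Hd] := hol_center rho0 hf e0.
  exists dl => // z /andP[za zr]; have := Hd _ zr.
  rewrite (addrC a) subrK => h.
  have za' : z - a != 0 by rewrite -cmod_gt0.
  have -> : (f z - f a) / (z - a) - dC f a = (f z - f a - dC f a * (z - a)) / (z - a) by field.
  by rewrite cmodM cmodV ler_pdivrMr.
Qed.

Lemma cauchy_quot_bound (q : R -> C) (d : C) (M : R) : ccont q 0 two_pi ->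
  circle_int q = rc two_pi * d -> (forall t, cmod (q t) <= M) -> cmod d <= 2 * M.
Proof.
move=> cq qd qM; have T0 := two_pi_gt0.
have := @cint_bound _ q 0 two_pi M (ltW T0) cq (fun t _ => qM t).
rewrite -/(circle_int q) qd subr0 cmodM cmod_rc gtr0_norm// mulrC ler_pM2r//.
Qed.

Lemma ccont_quot f a r (c : C) : 0 < r -> (forall t, exists d, has_cd f (a + rc r * cis t) d) ->
  ccont (fun t => (f (a + rc r * cis t) - c) / (rc r * cis t)) 0 two_pi.
Proof.
move=> r0 H.
have := @ccont_circ (fun z => (f z - c) / (z - a)) a r.
have -> : (fun t => (f (a + rc r * cis t) - c) / (a + rc r * cis t - a)) =
  (fun t => (f (a + rc r * cis t) - c) / (rc r * cis t)).
  by apply/funext => t; rewrite (_ : a + _ - a = rc r * cis t)//; ring.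
apply => t; have [d Hd] := H t.
have za' : (a + rc r * cis t) - a != 0 by rewrite -cmod_gt0 cmod_circ// ltW.
have h1 := has_cdB Hd (has_cd_cst c (a + rc r * cis t)).
have h2 := @has_cdV R (fun z => z - a) _ _ za' (has_cdB (has_cd_id (a + rc r * cis t)) (has_cd_cst a (a + rc r * cis t))).
by eexists; apply: has_cdM h1 h2.
Qed.

(** The constant 4 is the 2 of componentwise integration times the 2 of
    [cmod (f z - f a) <= 2 * M]. *)
Lemma cauchy1 f a rho r (M : R) : hol f a rho -> 0 < r < rho ->
  (forall z, cmod (z - a) <= r -> cmod (f z) <= M) -> cmod (dC f a) <= 4 * M / r.
Proof.
move=> hf rr fM; have /andP[r0 rrho] := rr.
have -> : 4 * M / r = 2 * (2 * M / r) by ring.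
apply: cauchy_quot_bound (cauchy_quot hf rr) _.
  apply: ccont_quot => // t; exists (dC f (a + rc r * cis t)); apply: hf.
  by rewrite cmod_circ// ltW.
move=> t; rewrite cmodM cmodV (cmod_rcis _ (ltW r0)) ler_pM2r ?invr_gt0//.
apply: le_trans (cmodB _ _) _.
have := fM (a + rc r * cis t); rewrite cmod_circ ?(ltW r0)// lexx => /(_ isT).
have := fM a; rewrite subrr cmod0 (ltW r0) => /(_ isT).
lra.
Qed.

Lemma segment_disc a (u h : C) (rho t : R) : cmod (u - a) < rho -> cmod (u + h - a) < rho ->
  0 <= t <= 1 -> cmod (u + rc t * h - a) < rho.
Proof.
move=> u1 u2 /andP[t0 t1].
have -> : u + rc t * h - a = rc (1 - t) * (u - a) + rc t * (u + h - a).
  by rewrite rcB rc1; ring.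
apply: le_lt_trans (cmodD _ _) _; rewrite !cmodM !cmod_rc !ger0_norm ?subr_ge0//.
have m : Num.max (cmod (u - a)) (cmod (u + h - a)) < rho by rewrite gt_max u1.
have [m1 m2] : cmod (u - a) <= Num.max (cmod (u - a)) (cmod (u + h - a)) /\
  cmod (u + h - a) <= Num.max (cmod (u - a)) (cmod (u + h - a)).
  by rewrite !le_max !lexx orbT.
have h1 : 0 <= 1 - t by rewrite subr_ge0.
have := ler_wpM2l h1 m1; have := ler_wpM2l t0 m2; lra.
Qed.

Lemma lipschitz_seg f (df : C -> C) (u h : C) (B : R) :
  (forall t : R, 0 <= t <= 1 -> has_cd f (u + rc t * h) (df (u + rc t * h))) ->
  (forall t : R, 0 <= t <= 1 -> cmod (df (u + rc t * h)) <= B) ->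
  cmod (f (u + h) - f u) <= 2 * B * cmod h.
Proof.
move=> H1 H2.
have := @mean_value_ineq _ (f \o (fun t => u + rc t * h)) (fun t => df (u + rc t * h) * h)
  (B * cmod h) 0 1 ltr01.
rewrite /= rc0 rc1 mul0r mul1r addr0 subr0 mulr1 mulrA; apply.
  by move=> t tt; apply: has_cd_rd (H1 _ tt); exact: has_rd_line.
by move=> t tt; rewrite cmodM ler_wpM2r ?cmod_ge0// H2.
Qed.

End CircleMean.

(** * Second-order estimates and Weierstrass' theorem *)

Section CauchyEstimates.
Variable R : realType.
Local Notation C := (Cc R).
Implicit Types (f g : C -> C) (a z : C).

(** [cauchy1] on the circle of radius [rho / 4] about [z], which stays inside the disc. *)
Lemma dC_bound f a (rho M : R) : 0 < rho -> hol f a rho ->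
  (forall z, cmod (z - a) < rho -> cmod (f z) <= M) ->
  forall z, cmod (z - a) < rho / 2 -> cmod (dC f z) <= 16 * M / rho.
Proof.
move=> r0 hf fM z za.
have hz : hol f z (rho / 2) by apply: holW hf; lra.
have rr : 0 < rho / 4 < rho / 2 by apply/andP; split; lra.
have -> : 16 * M / rho = 4 * M / (rho / 4) by field; rewrite gt_eqF.
apply: cauchy1 hz rr _ => w wz; apply: fM.
have -> : w - a = (w - z) + (z - a) by ring.
by apply: le_lt_trans (cmodD _ _) _; lra.
Qed.

Lemma hol_lipschitz f a (rho B : R) : hol f a rho ->
  (forall z, cmod (z - a) < rho -> cmod (dC f z) <= B) ->
  forall u h, cmod (u - a) < rho -> cmod (u + h - a) < rho ->
  cmod (f (u + h) - f u) <= 2 * B * cmod h.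
Proof.
move=> hf fB u h ua va; apply: (@lipschitz_seg _ f (dC f)) => t tt.
  by apply: hf; exact: segment_disc.
by apply: fB; exact: segment_disc.
Qed.

Lemma hol_lip f a (rho M : R) : 0 < rho -> hol f a rho ->
  (forall z, cmod (z - a) < rho -> cmod (f z) <= M) ->
  forall u h, cmod (u - a) < rho / 2 -> cmod (u + h - a) < rho / 2 ->
  cmod (f (u + h) - f u) <= 32 * M / rho * cmod h.
Proof.
move=> r0 hf fM u h ua va.
have hf2 : hol f a (rho / 2) by apply: holW hf; rewrite subrr cmod0; lra.
have := hol_lipschitz hf2 (dC_bound r0 hf fM) ua va.
by have -> : 2 * (16 * M / rho) = 32 * M / rho by ring.
Qed.

(** A second-order bound without a second derivative: [cauchy1] is applied to the increment
    [w |-> f (w + h) - f w], which is of size [cmod h] by [hol_lip]. *)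
Lemma dC_lip f a (rho M : R) : 0 < rho -> hol f a rho ->
  (forall z, cmod (z - a) < rho -> cmod (f z) <= M) ->
  forall z h, cmod (z - a) < rho / 4 -> cmod (z + h - a) < rho / 4 ->
  cmod (dC f (z + h) - dC f z) <= 2048 * M / rho ^+ 2 * cmod h.
Proof.
move=> r0 hf fM z h za zha.
have hd : cmod h < rho / 2.
  have -> : h = (z + h - a) - (z - a) by ring.
  by apply: le_lt_trans (cmodB _ _) _; lra.
pose g (w : C) := f (w + h) - f w.
have in1 w : cmod (w - z) < rho / 4 -> cmod (w - a) < rho / 2.
  have -> : w - a = (w - z) + (z - a) by ring.
  by move=> ?; apply: le_lt_trans (cmodD _ _) _; lra.
have in2 w : cmod (w - z) < rho / 4 -> cmod (w + h - a) < rho / 2.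
  have -> : w + h - a = (w - z) + (z + h - a) by ring.
  by move=> ?; apply: le_lt_trans (cmodD _ _) _; lra.
have gd w : cmod (w - z) < rho / 4 -> has_cd g w (dC f (w + h) - dC f w).
  move=> wz; apply: has_cdB; last by apply: hf; have := in1 _ wz; lra.
  rewrite -[dC f (w + h)]mulr1; apply: (@has_cd_comp _ f (fun w => w + h)).
    by rewrite -[1]addr0; apply: has_cdD; [exact: has_cd_id|exact: has_cd_cst].
  by apply: hf; have := in2 _ wz; lra.
have hg : hol g z (rho / 4) by move=> w wz; exact: dC_has_cd (gd _ wz).
have := @cauchy1 _ g z (rho / 4) (rho / 8) (32 * M / rho * cmod h) hg.
have zz : cmod (z - z) < rho / 4 by rewrite subrr cmod0; lra.
rewrite (has_cd_dC (gd z zz)).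
have -> : 4 * (32 * M / rho * cmod h) / (rho / 8) = 1024 * M / rho ^+ 2 * cmod h.
  by field; rewrite gt_eqF.
have M0 : 0 <= M.
  by apply: le_trans (fM a _); rewrite ?cmod_ge0// subrr cmod0.
have le : 1024 * M / rho ^+ 2 * cmod h <= 2048 * M / rho ^+ 2 * cmod h.
  rewrite ler_wpM2r ?cmod_ge0// ler_pM2r ?invr_gt0 ?exprn_gt0//; lra.
move=> H; apply: le_trans le; apply: H; first by apply/andP; split; lra.
move=> w wz; apply: (hol_lip r0 hf fM).
  by apply: in1; lra.
by apply: in2; lra.
Qed.

(** After subtracting the linear part, the derivative along the segment from [z] to [z + h] is
    [dC f w - dC f z], which [dC_lip] makes of size [cmod h]. *)
Lemma hol_taylor2 f a (rho M : R) : 0 < rho -> hol f a rho ->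
  (forall z, cmod (z - a) < rho -> cmod (f z) <= M) ->
  forall z h, cmod (z - a) < rho / 4 -> cmod (z + h - a) < rho / 4 ->
  cmod (f (z + h) - f z - dC f z * h) <= 4096 * M / rho ^+ 2 * cmod h ^+ 2.
Proof.
move=> r0 hf fM z h za zha.
have M0 : 0 <= M.
  by apply: le_trans (fM a _); rewrite ?cmod_ge0// subrr cmod0.
pose g (w : C) := f w - dC f z * w.
have -> : f (z + h) - f z - dC f z * h = g (z + h) - g z by rewrite /g; ring.
have -> : 4096 * M / rho ^+ 2 * cmod h ^+ 2 = 2 * (2048 * M / rho ^+ 2 * cmod h) * cmod h by ring.
apply: (@lipschitz_seg _ g (fun w => dC f w - dC f z)) => t tt;
    have zt := segment_disc za zha tt.
  apply: has_cdB; first by apply: hf; lra.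
  have := has_cdM (has_cd_cst (dC f z) (z + rc t * h)) (has_cd_id (z + rc t * h)).
  by rewrite mulr1 mulr0 addr0.
apply: le_trans (dC_lip r0 hf fM za zt) _.
have L0 : 0 <= 2048 * M / rho ^+ 2.
  by apply: divr_ge0; [apply: mulr_ge0; [exact: ler0n|exact: M0]|exact: sqr_ge0].
rewrite cmodM cmod_rc; move: (2048 * M / rho ^+ 2) L0 => L L0; apply: ler_wpM2l => //.
have /andP[t0 t1] := tt.
by rewrite ger0_norm// ler_piMl ?cmod_ge0.
Qed.

Lemma le_of_linear_error (X Y : R) (K eta : R) : 0 < eta ->
  (forall h : R, 0 < h < eta -> X <= Y + K * h) -> X <= Y.
Proof.
move=> e0 H; apply/ler_addgt0Pr => e ep.
have K1 : 0 < `|K| + 1 by rewrite ltr_wpDl.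
pose h := Num.min (eta / 2) (e / (`|K| + 1)).
have h0 : 0 < h by rewrite lt_min !divr_gt0.
have he : h < eta by rewrite /h gt_min; apply/orP; left; lra.
apply: le_trans (H h _) _; rewrite ?h0// lerD2l.
apply: (@le_trans _ _ ((`|K| + 1) * h)).
  rewrite ler_pM2r//; have := ler_norm K; lra.
by rewrite mulrC -ler_pdivlMr// ge_min lexx orbT.
Qed.

(* Choosing h of size |k|^2 in the Taylor estimate at increment k makes the
   approximation error K * h negligible. *)
Lemma weierstrass (gh : R -> C -> C) f a (rho eta M K : R) :
  0 < rho -> 0 < eta ->
  (forall h, 0 < h < eta -> hol (gh h) a rho) ->
  (forall h, 0 < h < eta -> forall z, cmod (z - a) < rho -> cmod (gh h z) <= M) ->
  (forall h, 0 < h < eta -> forall z, cmod (z - a) < rho -> cmod (gh h z - f z) <= K * h) ->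
  exists2 d, has_cd f a d & forall g (kap : R), hol g a rho ->
    (forall z, cmod (z - a) < rho -> cmod (g z - f z) <= kap) ->
    cmod (dC g a - d) <= 16 * kap / rho.
Proof.
move=> r0 eta0 hg gM gf.
have in0 : cmod (a - a) < rho by rewrite subrr cmod0.
have M0 : 0 <= M.
  have he : 0 < eta / 2 < eta by apply/andP; split; lra.
  exact: le_trans (cmod_ge0 _) (gM _ he a in0).
(* The Lipschitz bound, uniform in the approximations, passes to their limit [f]. *)
have lipf u h : cmod (u - a) < rho / 2 -> cmod (u + h - a) < rho / 2 ->
    cmod (f (u + h) - f u) <= 32 * M / rho * cmod h.
  move=> ua va; apply: (@le_of_linear_error _ _ (2 * K) eta eta0) => s se.
  have := hol_lip r0 (hg s se) (gM s se) ua va.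
  have u1 : cmod (u - a) < rho by lra.
  have v1 : cmod (u + h - a) < rho by lra.
  have := gf s se _ u1; have := gf s se _ v1.
  have -> : f (u + h) - f u = (gh s (u + h) - gh s u) - (gh s (u + h) - f (u + h)) + (gh s u - f u) by ring.
  move=> h1 h2 h3.
  apply: le_trans (cmodD _ _) _.
  have := cmodB (gh s (u + h) - gh s u) (gh s (u + h) - f (u + h)); lra.
pose r := rho / 4.
have rp : 0 < r by rewrite /r; lra.
have rr : 0 < r < rho by rewrite rp /r; lra.
have T0 := two_pi_gt0 R.
have cq : ccont (fun t => (f (a + rc r * cis t) - f a) / (rc r * cis t)) 0 (two_pi R).
  apply: ccontM; last first.
    apply: ccontP => t _.
    have h := @has_cdV R (fun z => z) _ _ (rcis_neq0 t rp) (has_cd_id (rc r * cis t)).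
    exact: has_rd_cont (has_cd_rd (has_rd_rcis r t) h).
  apply: ccontP => t _ e e0.
  have L0 : 0 < 32 * M / rho + 1 by rewrite ltr_wpDl// divr_ge0 ?mulr_ge0// ltW.
  have [dl dl0 Hd] := has_rd_cont (has_rd_circ a r t) (divr_gt0 e0 L0).
  exists dl => // s /Hd H.
  have -> : f (a + rc r * cis (t + s)) - f a - (f (a + rc r * cis t) - f a) =
     f (a + rc r * cis (t + s)) - f (a + rc r * cis t) by ring.
  have in1 t' : cmod (a + rc r * cis t' - a) < rho / 2.
    by rewrite cmod_circ ?(ltW rp)// /r; lra.
  have := lipf (a + rc r * cis t) (a + rc r * cis (t + s) - (a + rc r * cis t)) (in1 t).
  rewrite (addrC _ (_ - _)) subrK => /(_ (in1 _)) h; apply: le_trans h _.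
  apply: (@le_trans _ _ ((32 * M / rho + 1) * (e / (32 * M / rho + 1)))).
    apply: ler_pM => //; rewrite ?cmod_ge0 ?lerDl//.
    by rewrite divr_ge0 ?mulr_ge0// ltW.
  by rewrite mulrC divfK// gt_eqF.
(* The candidate derivative is the Cauchy integral of [f] itself; it makes sense because [f] is
   already known to be continuous on the circle. Linearity of this integral compares [d] with [dC g]
   for any [g] close to [f]. *)
pose d := circle_int (fun t => (f (a + rc r * cis t) - f a) / (rc r * cis t)) / rc (two_pi R).
have Kr' g kap : hol g a rho ->
    (forall z, cmod (z - a) < rho -> cmod (g z - f z) <= kap) ->
    cmod (dC g a - d) <= 16 * kap / rho.
  move=> hg' gf'.
  have -> : 16 * kap / rho = 2 * (2 * kap / r) by rewrite /r; field; rewrite gt_eqF.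
  have in1 t' : cmod (a + rc r * cis t' - a) < rho.
    by rewrite cmod_circ ?(ltW rp)// /r; lra.
  have cg : ccont (fun t => (g (a + rc r * cis t) - g a) / (rc r * cis t)) 0 (two_pi R).
    apply: ccont_quot => // t; eexists; apply: hg'; exact: in1.
  apply: (@cauchy_quot_bound _ (fun t => (g (a + rc r * cis t) - g a) / (rc r * cis t)
     - (f (a + rc r * cis t) - f a) / (rc r * cis t))).
  - have := ccontD cg (ccontM (ccont_cst (-1) 0 (two_pi R)) cq).
    by congr ccont; apply/funext => t; rewrite mulN1r.
  - rewrite /circle_int (cintB cg cq) -!/(circle_int _) (cauchy_quot hg' rr) /d.
    by rewrite mulrBr (mulrC _ (_ / _)) divfK// rc_two_pi_neq0.
  - move=> t; rewrite -mulrBl cmodM cmodV (cmod_rcis _ (ltW rp)) ler_pM2r ?invr_gt0//.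
    have -> : g (a + rc r * cis t) - g a - (f (a + rc r * cis t) - f a) =
     (g (a + rc r * cis t) - f (a + rc r * cis t)) - (g a - f a) by ring.
    apply: le_trans (cmodB _ _) _.
    have := gf' _ (in1 t); have := gf' _ in0; lra.
have Kr s : 0 < s < eta -> cmod (dC (gh s) a - d) <= 2 * (2 * K * s / r).
  move=> se; apply: le_trans (Kr' _ _ (hg s se) (gf s se)) _.
  by rewrite le_eqVlt; apply/orP; left; apply/eqP; rewrite /r; field; rewrite gt_eqF.
exists d => // e e0.
pose A := 2 * K + 4096 * M / rho ^+ 2 + 4 * K / r.
have A1 : 0 < `|A| + 1 by rewrite ltr_wpDl.
exists (Num.min (Num.min 1 eta) (Num.min r (e / (`|A| + 1)))).
  by rewrite !lt_min ltr01 eta0 rp divr_gt0.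
move=> k; rewrite !lt_min => /andP[/andP[k1 ke] /andP[kr kA]].
have [->|k0] := eqVneq k 0; first by rewrite addr0 mulr0 subrr subr0 cmod0 mulr0.
have kp : 0 < cmod k by rewrite cmod_gt0.
pose s := cmod k ^+ 2.
have sk : s <= cmod k by rewrite /s expr2 ler_piMr ?ltW.
have se : 0 < s < eta by rewrite exprn_gt0//=; exact: le_lt_trans sk ke.
have ak : cmod (a + k - a) < rho / 4 by rewrite addrC addKr.
have in1 : cmod (a - a) < rho / 4 by rewrite subrr cmod0; exact: rp.
have t2 := hol_taylor2 r0 (hg s se) (gM s se) in1 ak.
have ak' : cmod (a + k - a) < rho by apply: lt_trans ak _; case/andP: rr.
have e1 := gf s se _ in0; have e2 := gf s se _ ak'; have e3 := Kr s se.
have -> : f (a + k) - f a - d * k = (gh s (a + k) - gh s a - dC (gh s) a * k)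
   - (gh s (a + k) - f (a + k)) + (gh s a - f a) + (dC (gh s) a - d) * k by ring.
have K0 : 0 <= K.
  by rewrite -(pmulr_lge0 _ (_ : 0 < s)) ?(le_trans _ e1) ?cmod_ge0//; case/andP: se.
have e4 : cmod ((dC (gh s) a - d) * k) <= 4 * K / r * s.
  rewrite cmodM; apply: (@le_trans _ _ (cmod (dC (gh s) a - d))).
    by rewrite ler_piMr ?cmod_ge0// ltW.
  by apply: le_trans e3 _; rewrite le_eqVlt; apply/orP; left; apply/eqP; ring.
apply: (@le_trans _ _ (A * s)).
  apply: le_trans (cmodD _ _) _.
  have h1 := cmodD (gh s (a + k) - gh s a - dC (gh s) a * k - (gh s (a + k) - f (a + k))) (gh s a - f a).
  have h2 := cmodB (gh s (a + k) - gh s a - dC (gh s) a * k) (gh s (a + k) - f (a + k)).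
  have -> : A * s = 2 * (K * s) + 4096 * M / rho ^+ 2 * s + 4 * K / r * s by rewrite /A; ring.
  move: t2; rewrite -/s => t2; clear -t2 h1 h2 e1 e2 e4; lra.
rewrite /s expr2 mulrA ler_pM2r//.
apply: (@le_trans _ _ ((`|A| + 1) * cmod k)).
  by rewrite ler_pM2r//; apply: le_trans (ler_norm _) _; rewrite lerDl.
by rewrite mulrC -ler_pdivlMr// ltW.
Qed.

End CauchyEstimates.

(** * Higher derivatives and Cauchy estimates *)

Section HigherDerivatives.
Variable R : realType.
Local Notation C := (Cc R).
Implicit Types (f g : C -> C) (a z : C).

Definition diff_quot f (h z : C) : C := (f (z + h) - f z) / h.

Lemma diff_quot_bound f a (rho M : R) z h : 0 < rho -> hol f a rho ->
  (forall z, cmod (z - a) < rho -> cmod (f z) <= M) ->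
  cmod (z - a) < rho / 8 -> 0 < cmod h < rho / 8 -> cmod (diff_quot f h z) <= 32 * M / rho.
Proof.
move=> r0 hf fM za /andP[h0 hr]; rewrite /diff_quot cmodM cmodV ler_pdivrMr//.
apply: (hol_lip r0 hf fM); first by lra.
have -> : z + h - a = (z - a) + h by ring.
by apply: le_lt_trans (cmodD _ _) _; lra.
Qed.

Lemma diff_quot_lim f a (rho M : R) z h : 0 < rho -> hol f a rho ->
  (forall z, cmod (z - a) < rho -> cmod (f z) <= M) ->
  cmod (z - a) < rho / 8 -> 0 < cmod h < rho / 8 ->
  cmod (diff_quot f h z - dC f z) <= 4096 * M / rho ^+ 2 * cmod h.
Proof.
move=> r0 hf fM za /andP[h0 hr].
have hn : h != 0 by rewrite -cmod_gt0.
have -> : diff_quot f h z - dC f z = (f (z + h) - f z - dC f z * h) / h by rewrite /diff_quot; field.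
rewrite cmodM cmodV ler_pdivrMr// -[leRHS]mulrA -expr2.
apply: (hol_taylor2 r0 hf fM); first by lra.
have -> : z + h - a = (z - a) + h by ring.
by apply: le_lt_trans (cmodD _ _) _; lra.
Qed.

Lemma diff_quot_cd f h z c d : has_cd f (z + h) c -> has_cd f z d -> has_cd (diff_quot f h) z ((c - d) / h).
Proof.
move=> fc fd.
have fc' : has_cd (fun w => f (w + h)) z c.
  rewrite -[c]mulr1; apply: (@has_cd_comp _ f (fun w => w + h)) => //.
  by rewrite -[1]addr0; apply: has_cdD; [exact: has_cd_id|exact: has_cd_cst].
have := has_cdM (has_cdB fc' fd) (has_cd_cst h^-1 z).
by rewrite mulr0 add0r mulrC.
Qed.

(** Near each point [f] is bounded by continuity, so the difference quotients are uniformly bounded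
    and converge to [dC f] at a rate linear in [h], as [weierstrass] requires. *)
Lemma hol_dC f a (rho : R) : hol f a rho -> hol (dC f) a rho.
Proof.
move=> hf z za.
have [s s0 fs] := has_cd_cont (hf _ za) ltr01.
pose r := Num.min s (rho - cmod (z - a)).
have r0 : 0 < r by rewrite lt_min s0 subr_gt0.
have hz : hol f z r by apply: holW hf; rewrite -lerBrDl /r ge_min lexx orbT.
have fM w : cmod (w - z) < r -> cmod (f w) <= cmod (f z) + 1.
  rewrite lt_min => /andP[/fs ws _].
  have -> : f w = f z + (f w - f z) by ring.
  by apply: le_trans (cmodD _ _) _; rewrite lerD2l.
have rc_in h : 0 < h < r / 8 -> 0 < cmod (rc h : C) < r / 8.
  by move=> /andP[h0 h1]; rewrite cmod_rc gtr0_norm// h0.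
have r8 : 0 < r / 8 by lra.
have [|||d hd _] := @weierstrass R (fun h => diff_quot f (rc h)) (dC f) z (r / 8) (r / 8)
  (32 * (cmod (f z) + 1) / r) (4096 * (cmod (f z) + 1) / r ^+ 2) r8 r8.
- move=> h h8 w wz; apply: dC_has_cd; apply: diff_quot_cd; apply: hz; last by lra.
  have -> : w + rc h - z = (w - z) + rc h by ring.
  by have /andP[_ ?] := rc_in _ h8; apply: le_lt_trans (cmodD _ _) _; lra.
- by move=> h /rc_in h8 w wz; exact: diff_quot_bound r0 hz fM wz h8.
- move=> h h8 w wz; have := diff_quot_lim r0 hz fM wz (rc_in _ h8).
  by rewrite cmod_rc gtr0_norm//; case/andP: h8.
exact: dC_has_cd hd.
Qed.

Definition dCn n f : C -> C := iter n (@dC R) f.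

Lemma hol_dCn n f a (rho : R) : hol f a rho -> hol (dCn n f) a rho.
Proof.
by move=> hf; elim: n => [//|n IH]; rewrite /dCn iterS; apply: hol_dC.
Qed.

Lemma has_cdX f a c n : has_cd f a c ->
  has_cd (fun z => f z ^+ n.+1) a (n.+1%:R * f a ^+ n * c).
Proof.
move=> fc; elim: n => [|n IH]; first by rewrite expr0 !mul1r.
have := has_cdM fc IH; congr has_cd; rewrite exprS !mulrS; ring.
Qed.

Lemma ccont_hol f a rho r : hol f a rho -> 0 < r < rho ->
  ccont (fun t => f (a + rc r * cis t)) 0 (two_pi R).
Proof.
move=> hf /andP[r0 rr]; apply: ccont_circ => t; eexists; apply: hf.
by rewrite cmod_circ// ltW.
Qed.

Lemma ccont_pow r n : 0 < r -> ccont (fun t => (rc r * cis t : C) ^- n) 0 (two_pi R).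
Proof.
move=> r0; have h := @ccont_circ R (fun z => (z ^+ n)^-1) 0 r.
have -> : (fun t => (rc r * cis t : C) ^- n) = (fun t => ((0 + rc r * cis t : C) ^+ n)^-1).
  by apply/funext => t; rewrite add0r.
apply: h => t; rewrite add0r; case: n => [|n].
  exists 0; have := has_cd_cst (1 : C) (rc r * cis t : C).
  by congr has_cd; apply/funext => z; rewrite expr0 invr1.
eexists; apply: (@has_cdV R (fun z => z ^+ n.+1)); first by rewrite expf_neq0// rcis_neq0.
exact: has_cdX (has_cd_id _).
Qed.

(** The curve [f (a + w) * w ^- n.+1] along [w = r e^(it)] is periodic, so its derivative [i (f'(a +
    w) w^-n - (n+1) f(a + w) w^-(n+1))] integrates to zero. *)
Lemma by_parts f a rho r n : hol f a rho -> 0 < r < rho ->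
  circle_int (fun t => dC f (a + rc r * cis t) * (rc r * cis t) ^- n) =
  n.+1%:R * circle_int (fun t => f (a + rc r * cis t) * (rc r * cis t) ^- n.+1).
Proof.
move=> hf rr; have /andP[r0 rrho] := rr.
pose w t : C := rc r * cis t.
have wn t : w t != 0 by exact: rcis_neq0.
have c1 : ccont (fun t => dC f (a + w t) * w t ^- n) 0 (two_pi R).
  by apply: ccontM; [exact: ccont_hol (hol_dC hf) rr|exact: ccont_pow].
have c2 : ccont (fun t => f (a + w t) * w t ^- n.+1) 0 (two_pi R).
  by apply: ccontM; [exact: ccont_hol hf rr|exact: ccont_pow].
have c3 := ccontM (ccont_cst n.+1%:R 0 (two_pi R)) c2.
have c4 := ccontD c1 (ccontM (ccont_cst (-1) 0 (two_pi R)) c3).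
pose phi (z : C) := f (a + z) * (z ^+ n.+1)^-1.
have E : circle_int (fun t => @imag_unit R * (dC f (a + w t) * w t ^- n + -1 * (n.+1%:R * (f (a + w t) * w t ^- n.+1)))) = 0.
  rewrite /circle_int (@cint_ftc _ (phi \o w) _ _ _ (two_pi_gt0 R)).
  - have wT : w (two_pi R) = w 0 by rewrite /w /cis cexp_period.
    by rewrite /comp wT subrr.
  - by apply: ccontM => //; exact: ccont_cst.
  - move=> t _.
    have hw : has_cd f (a + w t) (dC f (a + w t)).
      by apply: hf; rewrite cmod_circ// ltW.
    have h1 := @has_cd_comp _ f (fun z => a + z) _ _ _ (has_cdD (has_cd_cst a (w t)) (has_cd_id (w t))) hw.
    have wX : w t ^+ n.+1 != 0 by rewrite expf_neq0.
    have h2 := @has_cdV R (fun z => z ^+ n.+1) (w t) _ wX (has_cdX n (has_cd_id (w t))).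
    have := has_cd_rd (has_rd_rcis r t) (has_cdM h1 h2).
    congr has_rd; rewrite -/(w t) /= !exprS.
    have wk : w t ^+ n != 0 by rewrite expf_neq0.
    by field; rewrite wn wk.
move: E; rewrite /circle_int cintZ// => /eqP; rewrite mulf_eq0 => /orP[|].
  by rewrite -cmod_eq0 /cmod /= expr0n expr1n /= add0r sqrtr1 oner_eq0.
rewrite (cintD c1 (ccontM (ccont_cst (-1) 0 (two_pi R)) c3)) (cintZ _ c3) (cintZ _ c2).
by rewrite mulN1r subr_eq0 => /eqP.
Qed.

(** The exponent [k] is free for the sake of the induction; at [k = 0] this becomes Cauchy's
    integral formula for the derivative of order [n]. *)
Lemma by_parts_iter n k f a rho r : hol f a rho -> 0 < r < rho ->
  k`!%:R * circle_int (fun t => dCn n f (a + rc r * cis t) * (rc r * cis t) ^- k) =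
  (n + k)`!%:R * circle_int (fun t => f (a + rc r * cis t) * (rc r * cis t) ^- (n + k)).
Proof.
elim: n f => [//|n IH] f hf rr.
rewrite /dCn iterSr -/(dCn n (dC f)) (IH _ (hol_dC hf) rr) (by_parts _ hf rr).
by rewrite addSn factS natrM; ring.
Qed.

(** By [circle_mean] the left side of [by_parts_iter] at [k = 0] is the value of the derivative at
    the centre, up to [2 pi]; the factor 2 comes from componentwise integration. *)
Lemma cauchy_estimate n f a rho r (M : R) : hol f a rho -> 0 < r < rho ->
  (forall z, cmod (z - a) = r -> cmod (f z) <= M) ->
  cmod (dCn n f a) <= 2 * (n`!%:R * M / r ^+ n).
Proof.
move=> hf rr fM; have /andP[r0 rrho] := rr.
have := by_parts_iter n 0 hf rr; rewrite fact0 mul1r addn0.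
have -> : (fun t => dCn n f (a + rc r * cis t) * (rc r * cis t) ^- 0) =
  (fun t => dCn n f (a + rc r * cis t)).
  by apply/funext => t; rewrite expr0 invr1 mulr1.
have rho0 := lt_trans r0 rrho.
have c2 : ccont (fun t => f (a + rc r * cis t) * (rc r * cis t) ^- n) 0 (two_pi R).
  by apply: ccontM; [exact: ccont_hol hf rr|exact: ccont_pow].
rewrite /circle_int -(cintZ _ c2) -!/(circle_int _).
rewrite (@circle_mean _ (dCn n f) a rho (dCn n f a)) => // [E|z /andP[_ zr]|e e0]; last 1 first.
- have [dl dl0 Hd] := has_cd_cont (hol_center rho0 (hol_dCn n hf)) e0.
  by exists dl => // z /andP[_ /Hd].
- apply: cauchy_quot_bound (esym E) _.
    by apply: ccontM => //; exact: ccont_cst.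
  move=> t; rewrite cmodM -rc_nat cmod_rc ger0_norm ?ler0n// -mulrA ler_pM2l ?ltr0n ?fact_gt0//.
  rewrite cmodM cmodV cmodX (cmod_rcis _ (ltW r0)) ler_pM2r ?invr_gt0 ?exprn_gt0//.
  by apply: fM; rewrite cmod_circ// ltW.
- by eexists; exact: hol_dCn hf _ zr.
Qed.

End HigherDerivatives.

(** * Functions of two complex variables *)

Section TwoVariables.
Variable R : realType.
Local Notation C := (Cc R).
Implicit Types (F G : C * C -> C) (z w : C * C).

Lemma quot_fst G (u v h : C) :
  h^-1 *: (G (h *: ((1 : C), (0 : C)) + (u, v)) - G (u, v)) =
  h^-1 *: (G (h *: (1 : C) + u, v) - G (u, v)).
Proof.
by rewrite (_ : _ + (u, v) = (h *: (1 : C) + u, h *: (0 : C) + v)) // scaler0 add0r.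
Qed.

Lemma quot_snd G (u v h : C) :
  h^-1 *: (G (h *: ((0 : C), (1 : C)) + (u, v)) - G (u, v)) =
  h^-1 *: (G (u, h *: (1 : C) + v) - G (u, v)).
Proof.
by rewrite (_ : _ + (u, v) = (h *: (0 : C) + u, h *: (1 : C) + v)) // scaler0 add0r.
Qed.

Lemma pd1E G u v : pd1 G (u, v) = dC (fun u' => G (u', v)) u.
Proof.
rewrite /pd1 /dC /derive.
by under eq_fun do rewrite quot_fst.
Qed.

Lemma pd2E G u v : pd2 G (u, v) = dC (fun v' => G (u, v')) v.
Proof.
rewrite /pd2 /dC /derive.
by under eq_fun do rewrite quot_snd.
Qed.

Lemma diff_has_cd1 F u v : differentiable F (u, v) ->
  has_cd (fun u' => F (u', v)) u (pd1 F (u, v)).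
Proof.
move=> dF; rewrite pd1E; apply/has_cdP/derivableP.
have : derivable F (u, v) (1, 0) by exact: diff_derivable.
rewrite /derivable; have /funext -> := quot_fst F u v; exact.
Qed.

Lemma diff_has_cd2 F u v : differentiable F (u, v) ->
  has_cd (fun v' => F (u, v')) v (pd2 F (u, v)).
Proof.
move=> dF; rewrite pd2E; apply/has_cdP/derivableP.
have : derivable F (u, v) (0, 1) by exact: diff_derivable.
rewrite /derivable; have /funext -> := quot_snd F u v; exact.
Qed.

Lemma diff_bounded F u v : differentiable F (u, v) -> exists2 r : R, 0 < r &
  exists M : R, forall u' v', cmod (u' - u) < r -> cmod (v' - v) < r -> cmod (F (u', v')) <= M.
Proof.
move=> /differentiable_continuous /cvgrPdist_le /(_ 1 ltr01) /nbhs_ballP[e e0 H].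
have [r r0 eE] := posC e0; exists r => //; exists (cmod (F (u, v)) + 1) => u' v' hu hv.
have := H (u', v'); rewrite /= norm_cmod -(rc1 R) rc_le => h.
have -> : F (u', v') = F (u, v) - (F (u, v) - F (u', v')) by ring.
apply: le_trans (cmodB _ _) _; rewrite lerD2l; apply: h; split.
  by rewrite -ball_normE /ball_ /= norm_cmod eE rc_lt cmodC.
by rewrite -ball_normE /ball_ /= norm_cmod eE rc_lt cmodC.
Qed.

(* Separately holomorphic and locally bounded functions: a class stable under
   both partial derivatives without any further argument on joint
   differentiability. *)
Definition sep_hol G := forall u v, D2 (u, v) ->
  [/\ has_cd (fun u' => G (u', v)) u (pd1 G (u, v)),
      has_cd (fun v' => G (u, v')) v (pd2 G (u, v)) &
      exists2 r : R, 0 < r & exists M : R, forall u' v',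
        cmod (u' - u) < r -> cmod (v' - v) < r -> cmod (G (u', v')) <= M].

Lemma analytic_sep_hol F : analytic_D2 F -> sep_hol F.
Proof.
move=> aF u v /aF dF.
by split; [exact: diff_has_cd1|exact: diff_has_cd2|exact: diff_bounded].
Qed.

Lemma disc_in (a w : C) (r : R) : cmod (w - a) < r -> r <= 1 - cmod a -> cmod w < 1.
Proof.
move=> h1 h2; have -> : w = (w - a) + a by rewrite subrK.
by apply: le_lt_trans (cmodD _ _) _; lra.
Qed.

Lemma sep_hol_slice1 G u v (r : R) : sep_hol G -> cmod v < 1 -> r <= 1 - cmod u ->
  hol (fun u' => G (u', v)) u r.
Proof.
move=> sG v1 r1 u' hu; have u'1 := disc_in hu r1.
by have [h _ _] := sG u' v (conj u'1 v1); exact: dC_has_cd h.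
Qed.

Lemma sep_hol_slice2 G u v (r : R) : sep_hol G -> cmod u < 1 -> r <= 1 - cmod v ->
  hol (fun v' => G (u, v')) v r.
Proof.
move=> sG u1 r1 v' hv; have v'1 := disc_in hv r1.
by have [_ h _] := sG u v' (conj u1 v'1); exact: dC_has_cd h.
Qed.

Lemma sep_hol_local G u v : sep_hol G -> D2 (u, v) -> exists r M : R,
  [/\ 0 < r, r <= 1 - cmod u, r <= 1 - cmod v & forall u' v',
        cmod (u' - u) < r -> cmod (v' - v) < r -> cmod (G (u', v')) <= M].
Proof.
move=> sG uv; have [_ _ [r r0 [M HM]]] := sG u v uv; have [/= u1 v1] := uv.
exists (Num.min r (Num.min (1 - cmod u) (1 - cmod v))), M; split.
- by rewrite !lt_min r0 !subr_gt0 u1 v1.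
- by rewrite !ge_min lexx !orbT.
- by rewrite !ge_min lexx !orbT.
- by move=> u' v'; rewrite !lt_min => /andP[h1 _] /andP[h2 _]; exact: HM.
Qed.

(** The difference quotients of [G] in the first variable, seen as functions of the second, converge
    uniformly to [pd1 G (u, _)]. By [weierstrass] this limit has a derivative [d], and the
    derivatives of the quotients tend to [d] too. The latter are the difference quotients of [pd2 G]
    in the first variable, so both mixed derivatives exist and are equal. *)
Lemma mixed_partial G u v : sep_hol G -> D2 (u, v) -> exists2 d : C,
  has_cd (fun v' => pd1 G (u, v')) v d & has_cd (fun u' => pd2 G (u', v)) u d.
Proof.
move=> sG uv; have [/= u1 v1] := uv.
have [r [M [r0 ru rv GM]]] := sep_hol_local sG uv.
have r8 : 0 < r / 8 by lra.
pose gh (h : C) (v' : C) := diff_quot (fun u' => G (u', v')) h u.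
have hs v' : cmod (v' - v) < r / 8 -> hol (fun u' => G (u', v')) u r.
  by move=> hv; apply: sep_hol_slice1 => //; apply: disc_in hv _; lra.
have bs v' : cmod (v' - v) < r / 8 -> forall u', cmod (u' - u) < r -> cmod (G (u', v')) <= M.
  by move=> hv u' hu; apply: GM => //; lra.
have uu : cmod (u - u) < r / 8 by rewrite subrr cmod0.
have uh h : 0 < cmod h < r / 8 -> cmod (u + h) < 1.
  by move=> /andP[_ h8]; apply: (@disc_in u _ r) => //; rewrite addrC addKr; lra.
have ghd (h : C) v' : 0 < cmod h < r / 8 -> cmod (v' - v) < r / 8 ->
    has_cd (gh h) v' ((pd2 G (u + h, v') - pd2 G (u, v')) / h).
  move=> h8 hv; have v'1 : cmod v' < 1 by apply: disc_in hv _; lra.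
  have [_ h1 _] := sG (u + h) v' (conj (uh _ h8) v'1).
  have [_ h2 _] := sG u v' (conj u1 v'1).
  have := has_cdM (has_cdB h1 h2) (has_cd_cst h^-1 v').
  by rewrite mulr0 add0r mulrC.
have ghl (h : C) : 0 < cmod h < r / 8 -> forall v', cmod (v' - v) < r / 8 ->
    cmod (gh h v' - pd1 G (u, v')) <= 4096 * M / r ^+ 2 * cmod h.
  by move=> h8 v' hv; rewrite pd1E; exact: diff_quot_lim r0 (hs _ hv) (bs _ hv) uu h8.
have rc_in h : 0 < h < r / 8 -> 0 < cmod (rc h : C) < r / 8.
  by move=> /andP[h0 h1]; rewrite cmod_rc gtr0_norm// h0.
have ghh (h : C) : 0 < cmod h < r / 8 -> hol (gh h) v (r / 8).
  by move=> h8 v' hv; exact: dC_has_cd (ghd _ _ h8 hv).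
have [|||d hd Hd] := @weierstrass R (fun h => gh (rc h)) (fun v' => pd1 G (u, v')) v (r / 8) (r / 8)
  (32 * M / r) (4096 * M / r ^+ 2) r8 r8.
- by move=> h /rc_in /ghh.
- by move=> h /rc_in h8 v' hv; exact: diff_quot_bound r0 (hs _ hv) (bs _ hv) uu h8.
- move=> h h8 v' hv; have := ghl _ (rc_in _ h8) _ hv.
  by rewrite cmod_rc gtr0_norm//; case/andP: h8.
exists d; first exact: hd.
move=> e e0.
have vv : cmod (v - v) < r / 8 by rewrite subrr cmod0.
pose K := 16 * (4096 * M / r ^+ 2) / (r / 8).
have K1 : 0 < `|K| + 1 by rewrite ltr_wpDl.
exists (Num.min (r / 8) (e / (`|K| + 1))); first by rewrite lt_min r8 divr_gt0.
move=> h; rewrite lt_min => /andP[h1 h2].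
have [->|hn] := eqVneq h 0; first by rewrite addr0 mulr0 subrr subr0 cmod0 mulr0.
have h8 : 0 < cmod h < r / 8 by rewrite cmod_gt0 hn.
(* Here [h] is an arbitrary complex increment, whereas the family given to [weierstrass] has a real
   parameter; the clause on arbitrary [g] bridges this. *)
have := Hd _ _ (ghh _ h8) (ghl _ h8); rewrite (has_cd_dC (ghd _ _ h8 vv)).
rewrite (_ : pd2 G (u + h, v) - pd2 G (u, v) - d * h =
  ((pd2 G (u + h, v) - pd2 G (u, v)) / h - d) * h); last first.
  by rewrite mulrBl divfK.
have -> : 16 * (4096 * M / r ^+ 2 * cmod h) / (r / 8) = K * cmod h.
  by rewrite mulrA mulrAC.
move=> h3; rewrite cmodM ler_wpM2r ?cmod_ge0//; apply: le_trans h3 _.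
apply: (@le_trans _ _ ((`|K| + 1) * cmod h)).
  by rewrite ler_wpM2r ?cmod_ge0//; apply: le_trans (ler_norm _) _; rewrite lerDl.
by rewrite mulrC -ler_pdivlMr// ltW.
Qed.

Lemma pd_comm G u v : sep_hol G -> D2 (u, v) -> pd2 (pd1 G) (u, v) = pd1 (pd2 G) (u, v).
Proof.
move=> sG uv; have [d h1 h2] := mixed_partial sG uv.
by rewrite (etrans (pd2E (pd1 G) u v) (has_cd_dC h1)) (etrans (pd1E (pd2 G) u v) (has_cd_dC h2)).
Qed.

Lemma sep_hol_pd1 G : sep_hol G -> sep_hol (pd1 G).
Proof.
move=> sG u v uv; have [/= u1 v1] := uv.
split.
- rewrite pd1E.
  have -> : (fun u' => pd1 G (u', v)) = dC (fun u' => G (u', v)).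
    by apply/funext => u'; rewrite pd1E.
  apply: dC_has_cd; apply: (@hol_center _ _ _ (1 - cmod u)); first by rewrite subr_gt0.
  by apply: hol_dC; exact: sep_hol_slice1.
- by rewrite pd2E; have [d h1 _] := mixed_partial sG uv; exact: dC_has_cd h1.
- have [r [M [r0 ru rv GM]]] := sep_hol_local sG uv.
  exists (r / 2); first by lra.
  exists (16 * M / r) => u' v' hu hv; rewrite pd1E.
  apply: (@dC_bound _ (fun u' => G (u', v')) u) hu => //.
    by apply: sep_hol_slice1 => //; apply: disc_in hv _; lra.
  by move=> z hz; apply: GM => //; lra.
Qed.

Lemma sep_hol_pd2 G : sep_hol G -> sep_hol (pd2 G).
Proof.
move=> sG u v uv; have [/= u1 v1] := uv.
split.
- by rewrite pd1E; have [d _ h1] := mixed_partial sG uv; exact: dC_has_cd h1.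
- rewrite pd2E.
  have -> : (fun v' => pd2 G (u, v')) = dC (fun v' => G (u, v')).
    by apply/funext => v'; rewrite pd2E.
  apply: dC_has_cd; apply: (@hol_center _ _ _ (1 - cmod v)); first by rewrite subr_gt0.
  by apply: hol_dC; exact: sep_hol_slice2.
- have [r [M [r0 ru rv GM]]] := sep_hol_local sG uv.
  exists (r / 2); first by lra.
  exists (16 * M / r) => u' v' hu hv; rewrite pd2E.
  apply: (@dC_bound _ (fun v' => G (u', v')) v) hv => //.
    by apply: sep_hol_slice2 => //; apply: disc_in hu _; lra.
  by move=> z hz; apply: GM => //; lra.
Qed.

Lemma sep_hol_pderiv p q G : sep_hol G -> sep_hol (pderiv p q G).
Proof.
move=> sG; rewrite /pderiv; elim: p => [|p IH]; last by rewrite iterS; exact: sep_hol_pd1.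
by elim: q => [|q IH] //; rewrite iterS; exact: sep_hol_pd2.
Qed.

Lemma has_cd_local (f g : C -> C) a d (r : R) : 0 < r ->
  (forall x, cmod (x - a) < r -> f x = g x) -> has_cd f a d -> has_cd g a d.
Proof.
move=> r0 fg fd e e0; have [dl dl0 Hd] := fd e e0.
exists (Num.min dl r); first by rewrite lt_min dl0.
move=> h; rewrite lt_min => /andP[/Hd h1 h2].
by rewrite -!fg ?subrr ?cmod0// addrC addKr.
Qed.

(** [pderiv] differentiates in the second variable first, so an outer [pd2] must be moved past [p]
    copies of [pd1]. The induction hypothesis only holds inside the bidisc, hence the appeal to
    locality of the derivative. *)
Lemma pd2_pderiv p q G u v : sep_hol G -> D2 (u, v) ->
  pd2 (pderiv p q G) (u, v) = pderiv p q.+1 G (u, v).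
Proof.
move=> sG; elim: p u v => [//|p IH] u v uv.
have -> : pderiv p.+1 q G = pd1 (pderiv p q G) by [].
have -> : pderiv p.+1 q.+1 G = pd1 (pderiv p q.+1 G) by [].
have [/= u1 v1] := uv.
rewrite (pd_comm (sep_hol_pderiv p q sG) uv).
have [h _ _] := sep_hol_pd2 (sep_hol_pderiv p q sG) uv.
have u0 : 0 < 1 - cmod u by rewrite subr_gt0.
rewrite (pd1E (pderiv p q.+1 G) u v); apply/esym/has_cd_dC.
apply: has_cd_local u0 _ h => x hx.
by apply: IH; split => //=; exact: disc_in hx _.
Qed.

Lemma iter_pd1 p G u v : iter p (@pd1 R) G (u, v) = dCn p (fun u' => G (u', v)) u.
Proof.
elim: p u => [|p IH] u; first by [].
transitivity (dC (fun u' => iter p (@pd1 R) G (u', v)) u); first exact: pd1E.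
rewrite /dCn iterS; congr (dC _ u).
by apply/funext => u'; exact: IH.
Qed.

Lemma iter_pd2 q G u v : iter q (@pd2 R) G (u, v) = dCn q (fun v' => G (u, v')) v.
Proof.
elim: q v => [|q IH] v; first by [].
transitivity (dC (fun v' => iter q (@pd2 R) G (u, v')) v); first exact: pd2E.
rewrite /dCn iterS; congr (dC _ v).
by apply/funext => v'; exact: IH.
Qed.

(** The one-variable estimate is used in the second variable for each point of a circle in the
    first, then in the first variable; the two factors 2 give 4. *)
Lemma cauchy_estimate2 p q G u v (r1 r2 M : R) : sep_hol G ->
  0 < r1 < 1 - cmod u -> 0 < r2 < 1 - cmod v ->
  (forall u' v', cmod (u' - u) <= r1 -> cmod (v' - v) <= r2 -> cmod (G (u', v')) <= M) ->
  cmod (pderiv p q G (u, v)) <= 4 * (p`!%:R * q`!%:R * M / (r1 ^+ p * r2 ^+ q)).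
Proof.
move=> sG ru rv GM.
have /andP[r10 ru'] := ru; have /andP[r20 rv'] := rv.
have u1 : cmod u < 1 by lra.
have v1 : cmod v < 1 by lra.
have sq : sep_hol (iter q (@pd2 R) G) by exact: (sep_hol_pderiv 0 q sG).
rewrite /pderiv iter_pd1.
have h1 := sep_hol_slice1 sq v1 (lexx (1 - cmod u)).
have b1 u' : cmod (u' - u) = r1 ->
    cmod (iter q (@pd2 R) G (u', v)) <= 2 * (q`!%:R * M / r2 ^+ q).
  move=> hu; rewrite iter_pd2; apply: (@cauchy_estimate _ _ _ _ (1 - cmod v)) => //.
    apply: sep_hol_slice2 => //.
    by have -> : u' = (u' - u) + u; [rewrite subrK|apply: le_lt_trans (cmodD _ _) _; lra].
  by move=> v' hv; apply: GM; rewrite ?hu ?hv.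
have := cauchy_estimate p h1 ru b1.
congr (_ <= _); field.
by rewrite !expf_neq0 ?gt_eqF.
Qed.

End TwoVariables.

(** * A Gronwall inequality for finite families *)

Section Gronwall.
Variable R : realType.
Local Notation C := (Cc R).
Local Notation Re := (@complex.Re R).
Local Notation Im := (@complex.Im R).

Lemma is_derive_seq (I : eqType) (s : seq I) (f df : I -> R -> R) (t : R) :
  (forall i, i \in s -> is_derive t 1 (f i) (df i t)) ->
  is_derive t 1 (fun x => \sum_(i <- s) f i x) (\sum_(i <- s) df i t).
Proof.
elim: s => [|i s IH] H.
  rewrite big_nil (_ : (fun _ => _) = cst 0); last by apply/funext => x; rewrite big_nil.
  exact: is_derive_cst.
rewrite big_cons (_ : (fun _ => _) = (f i) \+ (fun x => \sum_(i <- s) f i x)); last first.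
  by apply/funext => x; rewrite big_cons.
apply: is_deriveD; first by apply: H; rewrite mem_head.
by apply: IH => j js; apply: H; rewrite inE js orbT.
Qed.

(** Expand the square into a double sum and use [x_i x_j <= (x_i^2 + x_j^2) / 2]. *)
Lemma sum_sqr (I : eqType) (s : seq I) (x : I -> R) :
  (\sum_(i <- s) x i) ^+ 2 <= (size s)%:R * \sum_(i <- s) x i ^+ 2.
Proof.
have E : \sum_(i <- s) \sum_(j <- s) (x i ^+ 2 + x j ^+ 2) / 2 =
    (size s)%:R * \sum_(i <- s) x i ^+ 2.
  have cst (y : R) : \sum_(j <- s) y = (size s)%:R * y.
    by rewrite big_const_seq count_predT iter_addr_0 mulr_natl.
  under eq_bigr => i _ do rewrite -mulr_suml big_split /= cst.
  by rewrite -mulr_suml big_split /= cst -mulr_sumr; field.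
rewrite -E.
rewrite expr2 mulr_suml; apply: ler_sum => i _.
rewrite mulr_sumr; apply: ler_sum => j _.
have := sqr_ge0 (x i - x j); rewrite sqrrB; lra.
Qed.

(** A modulus need not be differentiable where it vanishes, so the argument runs on the sum of
    squares [u]. With [n] the length of [s] and [ka = 2 A n], one gets [u' <= 2 A S^2 <= ka u], so
    [u(t) e^(-ka t)] does not increase. The return to [S] is by [S(1)^2 <= n u(1)] and
    [u(0) <= S(0)^2]. *)
Lemma gronwall (I : eqType) (s : seq I) (phi psi : I -> R -> C) (A : R) : 0 <= A ->
  (forall i (t : R), i \in s -> 0 <= t <= 1 -> has_rd (phi i) t (psi i t)) ->
  (forall i (t : R), i \in s -> 0 <= t <= 1 -> cmod (psi i t) <= A * \sum_(j <- s) cmod (phi j t)) ->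
  \sum_(j <- s) cmod (phi j 1) <=
    ((size s)%:R * expR (2 * A * (size s)%:R) + 1) * \sum_(j <- s) cmod (phi j 0).
Proof.
move=> A0 dphi bpsi.
set n := (size s)%:R; have n0 : 0 <= n by exact: ler0n.
pose S t := \sum_(j <- s) cmod (phi j t).
have S0 t : 0 <= S t by apply: sumr_ge0 => i _; exact: cmod_ge0.
pose w i t := cmod (phi i t) ^+ 2.
pose dw i t := 2 * (Re (phi i t) * Re (psi i t) + Im (phi i t) * Im (psi i t)).
pose u t := \sum_(i <- s) w i t.
have dwP i (t : R) : i \in s -> 0 <= t <= 1 -> is_derive t 1 (w i) (dw i t).
  move=> si tt; have h := dphi i t si tt.
  have h1 := has_rd_Re h; have h2 := has_rd_Im h.
  have -> : w i = ((Re \o phi i) * (Re \o phi i)) + ((Im \o phi i) * (Im \o phi i)).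
    by apply/funext => x; rewrite /w cmod_sqr !expr2.
  have := is_deriveD (is_deriveM h1 h1) (is_deriveM h2 h2).
  by congr is_derive; rewrite /dw /GRing.scale /=; ring.
have duP (t : R) : 0 <= t <= 1 -> is_derive t 1 u (\sum_(i <- s) dw i t).
  by move=> tt; apply: is_derive_seq => i si; exact: dwP.
pose ka := 2 * A * n.
have dle (t : R) : 0 <= t <= 1 -> \sum_(i <- s) dw i t <= ka * u t.
  move=> tt; apply: (@le_trans _ _ (2 * A * S t ^+ 2)); last first.
    rewrite /ka -[leRHS]mulrA; apply: ler_wpM2l; [by rewrite mulr_ge0|exact: sum_sqr].
  rewrite expr2 [S t in X in _ <= _ * X]/S mulr_suml mulr_sumr.
  rewrite big_seq_cond [leRHS]big_seq_cond; apply: ler_sum => i /andP[si _].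
  have h := bpsi i t si tt.
  apply: (@le_trans _ _ (2 * (cmod (phi i t) * cmod (psi i t)))).
    rewrite /dw ler_pM2l//.
    (* The real inner product is the real part of [phi] times the conjugate of [psi], hence at most
       the product of the moduli. *)
    have -> : Re (phi i t) * Re (psi i t) + Im (phi i t) * Im (psi i t) =
      Re (phi i t * Complex (Re (psi i t)) (- Im (psi i t))).
      by rewrite cReM /=; ring.
    apply: le_trans (ler_norm _) _; apply: le_trans (cRe_le _) _.
    by rewrite cmodM /cmod; case: (psi i t) => x y /=; rewrite sqrrN.
  have -> : 2 * A * (cmod (phi i t) * S t) = 2 * (cmod (phi i t) * (A * S t)) by ring.
  by rewrite ler_pM2l// ler_wpM2l ?cmod_ge0.
pose v t := u t * expR (- ka * t).
pose dv t := (\sum_(i <- s) dw i t - ka * u t) * expR (- ka * t).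
have dvP (t : R) : 0 <= t <= 1 -> is_derive t 1 v (dv t).
  move=> tt; have h := duP t tt.
  have h2 : is_derive t (1 : R) (fun x => - ka * x) (- ka).
    have := @is_deriveZ _ _ _ id (- ka) t 1 1 (is_derive_id _ _).
    by rewrite /GRing.scale /= mulr1.
  have h3 := is_derive1_comp (f := expR) (is_derive_expR (- ka * t)) h2.
  have := is_deriveM h h3; rewrite /GRing.scale /=.
  by congr is_derive; rewrite /dv /=; ring.
have v10 : v 1 <= v 0.
  have [||c] := @MVT R v dv 0 1 ltr01.
  - by move=> x; rewrite in_itv /= => /andP[x0 x1]; apply: dvP; rewrite !ltW.
  - apply: cont_on_within => t /dvP [d _].
    by apply: differentiable_continuous; exact/derivable1_diffP.
  rewrite in_itv /= => /andP[c0 c1] E; rewrite -subr_le0 E subr0 mulr1 /dv.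
  by rewrite mulr_le0_ge0 ?expR_ge0// subr_le0 dle// !ltW.
have u10 : u 1 <= expR ka * u 0.
  move: v10; rewrite /v mulr1 mulr0 expR0 mulr1 expRN => h.
  by rewrite mulrC -ler_pdivrMr ?expR_gt0.
have uS : u 0 <= S 0 ^+ 2.
  rewrite expr2 {1}/S mulr_suml /u big_seq_cond [leRHS]big_seq_cond.
  apply: ler_sum => i /andP[si _].
  rewrite /w expr2 ler_wpM2l ?cmod_ge0// /S (big_rem i) //= lerDl.
  by apply: sumr_ge0 => j _; exact: cmod_ge0.
(* The [+ 1] makes the constant at least one and so at most its square, which replaces taking the
   square root of [n * expR ka]. *)
have K1 : 1 <= n * expR ka + 1 by rewrite lerDr mulr_ge0 ?expR_ge0.
rewrite -/(S 1) -/(S 0) -/ka.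
rewrite -(@ler_pXn2r _ 2)// ?nnegrE ?mulr_ge0 ?(le_trans ler01 K1)//.
apply: le_trans (sum_sqr _ _) _; rewrite -/n -/(u 1).
have h : n * u 1 <= n * expR ka * S 0 ^+ 2.
  rewrite -mulrA; apply: ler_wpM2l => //; apply: le_trans u10 _.
  by apply: ler_wpM2l => //; exact: expR_ge0.
apply: le_trans h _; rewrite exprMn; apply: ler_wpM2r; first exact: sqr_ge0.
apply: (@le_trans _ _ (n * expR ka + 1)); first by rewrite lerDl.
by rewrite expr2 ler_peMl// (le_trans ler01 K1).
Qed.

End Gronwall.

(** * Sums over multi-indices and growth along coordinate lines *)

Section Sums.
Variable R : realType.

Lemma esum_subset_le (T : choiceType) (I : set T) (a b : T -> R) :
  (forall k, 0 <= b k) -> (forall k, I k -> a k <= b k) ->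
  (\esum_(k in I) (a k)%:E <= \esum_(k in [set: T]) (b k)%:E)%E.
Proof.
move=> b0 ab; rewrite esum_mkcond; apply: le_esum => k _.
by case: ifPn => [/set_mem /ab|_]; rewrite lee_fin.
Qed.

Lemma geometric_esum (c q : R) : 0 <= c -> 0 <= q < 1 ->
  (\esum_(j in [set: nat]) (c * q ^+ j)%:E <= (c / (1 - q))%:E)%E.
Proof.
move=> c0 /andP[q0 q1].
have t0 j : 0 <= c * q ^+ j by rewrite mulr_ge0// exprn_ge0.
rewrite -nneseries_esumT; last by move=> j; rewrite lee_fin.
apply: lime_le; first by apply: is_cvg_nneseries => j _ _; rewrite lee_fin.
near=> n; rewrite sumEFin lee_fin ler_pdivlMr ?subr_gt0//.
have -> : (\sum_(0 <= j < n) c * q ^+ j) * (1 - q) = c * (1 - q ^+ n).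
  elim: (n) => [|m IH]; first by rewrite big_nil expr0 subrr mulr0 mul0r.
  by rewrite big_nat_recr//= mulrDl IH exprSr; ring.
by rewrite ler_piMr// lerBlDr lerDl exprn_ge0.
Unshelve. all: by end_near. Qed.

Lemma geometric_esum2 (c q : R) : 0 <= c -> 0 <= q < 1 ->
  (\esum_(k in [set: nat * nat]) (c * q ^+ (k.1 + k.2))%:E <= (c / (1 - q) / (1 - q))%:E)%E.
Proof.
move=> c0 q01; have /andP[q0 q1] := q01.
have t0 i : 0 <= c * q ^+ i by rewrite mulr_ge0// exprn_ge0.
have -> : [set: nat * nat] = [set: nat] `*`` (fun=> [set: nat]) by apply/seteqP; split.
rewrite -(@esum_esum _ _ _ [set: nat] (fun=> [set: nat]) (fun i j => (c * q ^+ (i + j))%:E)); last first.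
  by move=> i j _ _; rewrite lee_fin.
apply: (@le_trans _ _ (\esum_(i in [set: nat]) (c / (1 - q) * q ^+ i)%:E)).
  apply: le_esum => i _; have := geometric_esum (t0 i) q01.
  rewrite (_ : c / (1 - q) * q ^+ i = c * q ^+ i / (1 - q)); last by rewrite mulrAC.
  by congr (_ <= _)%E; apply: eq_esum => j _; rewrite -mulrA -exprD.
by apply: geometric_esum => //; rewrite divr_ge0// subr_ge0 ltW.
Qed.

(** The triangle as a list, the form of index set that [gronwall] takes; [sum_multi_idx] connects it
    with the double sums of the statement. *)
Definition multi_idx (N : nat) : seq (nat * nat) :=
  [seq k <- [seq (i, j) | i <- index_iota 0 N.+1, j <- index_iota 0 N.+1] | (k.1 + k.2 <= N)%N].

Lemma mem_multi_idx N k : (k \in multi_idx N) = (k.1 + k.2 <= N)%N.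
Proof.
rewrite mem_filter; case: k => i j; rewrite [_.1]/= [_.2]/=.
case: (leqP (i + j)%N N) => h; last by [].
rewrite andTb; apply: allpairs_f; rewrite mem_index_iota ltnS leq0n andTb.
  exact: leq_trans (leq_addr _ _) h.
exact: leq_trans (leq_addl _ _) h.
Qed.

Lemma sum_multi_idx N (f : nat -> nat -> R) :
  \sum_(k1 < N.+1) \sum_(k2 < N.+1 | (k1 + k2 <= N)%N) f k1 k2 =
  \sum_(k <- multi_idx N) f k.1 k.2.
Proof.
rewrite [RHS]big_filter [RHS]big_mkcond big_allpairs /= big_mkord.
by apply: eq_bigr => i _; rewrite big_mkord [LHS]big_mkcond.
Qed.

Lemma le_sum_mem (I : eqType) (s : seq I) (f : I -> R) i : i \in s -> (forall j, 0 <= f j) ->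
  f i <= \sum_(j <- s) f j.
Proof. by move=> si f0; rewrite (big_rem i)//= lerDl sumr_ge0. Qed.

Definition triangle_max (N : nat) (f : nat -> nat -> R) : R :=
  \big[Num.max/0]_(k1 < N.+1) \big[Num.max/0]_(k2 < N.+1 | (k1 + k2 <= N)%N) f k1 k2.

Lemma le_triangle_max N f i j : (i + j <= N)%N -> f i j <= triangle_max N f.
Proof.
move=> ij; have hi : (i < N.+1)%N by rewrite ltnS (leq_trans (leq_addr _ _) ij).
have hj : (j < N.+1)%N by rewrite ltnS (leq_trans (leq_addl _ _) ij).
apply: le_trans (le_bigmax_cond _ _ (j := Ordinal hi) _) => //.
exact: (le_bigmax_cond _ _ (j := Ordinal hj)).
Qed.

Lemma triangle_max_ge0 N f : 0 <= triangle_max N f.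
Proof. exact: bigmax_ge_id. Qed.

Lemma triangle_max_le N f (m : R) : 0 <= m -> (forall i j, (i + j <= N)%N -> f i j <= m) -> triangle_max N f <= m.
Proof. by move=> m0 H; apply: bigmax_le => // i _; apply: bigmax_le => // j /H. Qed.

End Sums.

(** * Weighted derivatives with frozen weights along coordinate segments *)

Section Growth.
Variable R : realType.
Local Notation C := (Cc R).
Implicit Types (F : C * C -> C) (k : nat * nat) (a b : R).

(** The values of [l1] and [l2] are replaced by free reals, so that they can stay fixed while the
    point moves. *)
Definition weight (a1 a2 : R) k : R := k.1`!%:R * k.2`!%:R * a1 ^+ k.1 * a2 ^+ k.2.

Lemma weight_gt0 a1 a2 k : 0 < a1 -> 0 < a2 -> 0 < weight a1 a2 k.
Proof.
move=> a10 a20; rewrite /weight; apply: mulr_gt0; last exact: exprn_gt0.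
apply: mulr_gt0; last exact: exprn_gt0.
by apply: mulr_gt0; rewrite ltr0n fact_gt0.
Qed.

Lemma weightS1 a1 a2 i j : weight a1 a2 (i.+1, j) = weight a1 a2 (i, j) * (i.+1%:R * a1).
Proof. by rewrite /weight /= factS natrM exprS; ring. Qed.

Lemma weightS2 a1 a2 i j : weight a1 a2 (i, j.+1) = weight a1 a2 (i, j) * (j.+1%:R * a2).
Proof. by rewrite /weight /= factS natrM exprS; ring. Qed.

(** The weight is homogeneous of degree [k.1 + k.2] in [a1], [a2]; [1 <= B] then raises the exponent
    to [n]. *)
Lemma weight_compare (B a1 a2 b1 b2 : R) k n : 1 <= B -> 0 < a1 -> 0 < a2 -> 0 < b1 -> 0 < b2 ->
  b1 <= B * a1 -> b2 <= B * a2 -> (k.1 + k.2 <= n)%N -> weight b1 b2 k <= B ^+ n * weight a1 a2 k.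
Proof.
move=> B1 a10 a20 b10 b20 h1 h2 kn.
have B0 : 0 <= B by exact: le_trans ler01 B1.
apply: (@le_trans _ _ (B ^+ (k.1 + k.2) * weight a1 a2 k)); last first.
  by rewrite ler_wpM2r ?ler_weXn2l// ltW// weight_gt0.
rewrite /weight exprD.
have -> : B ^+ k.1 * B ^+ k.2 * (k.1`!%:R * k.2`!%:R * a1 ^+ k.1 * a2 ^+ k.2) =
  k.1`!%:R * k.2`!%:R * (B * a1) ^+ k.1 * (B * a2) ^+ k.2 by rewrite !exprMn; ring.
apply: ler_pM; rewrite ?mulr_ge0 ?exprn_ge0 ?ler0n ?(ltW b10) ?(ltW b20)//; last first.
  by apply: lerXn2r; rewrite ?nnegrE ?(ltW b20)// mulr_ge0// ltW.
rewrite ler_wpM2l ?mulr_ge0 ?ler0n//.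
by apply: lerXn2r; rewrite ?nnegrE ?(ltW b10)// mulr_ge0// ltW.
Qed.

Definition wterm F a1 a2 k (z : C * C) : R := cmod (pderiv k.1 k.2 F z) / weight a1 a2 k.

Definition wsum F N a1 a2 z : R := \sum_(k <- multi_idx N) wterm F a1 a2 k z.

Lemma wterm_ge0 F a1 a2 k z : 0 < a1 -> 0 < a2 -> 0 <= wterm F a1 a2 k z.
Proof. by move=> h1 h2; rewrite divr_ge0 ?cmod_ge0// ltW// weight_gt0. Qed.

Lemma wsum_ge0 F N a1 a2 z : 0 < a1 -> 0 < a2 -> 0 <= wsum F N a1 a2 z.
Proof. by move=> h1 h2; apply: sumr_ge0 => k _; exact: wterm_ge0. Qed.

Lemma nterm_wterm F (l1 l2 : C * C -> R) i j z :
  nterm F l1 l2 i j z = wterm F (l1 z) (l2 z) (i, j) z.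
Proof. by []. Qed.

(** The constant of [gronwall] at rate [N.+1 * b * A]. Differentiating a term once along [h] costs
    at most [N.+1] from the factorial, at most [b] from [cmod h] times the weight, and [A] from the
    bound on the terms of order up to [N + 1]. *)
Definition growth_const (N : nat) (b A : R) : R :=
  (size (multi_idx N))%:R * expR (2 * (N.+1%:R * b * A) * (size (multi_idx N))%:R) + 1.

Lemma growth_const_ge0 N b A : 0 <= growth_const N b A.
Proof. by rewrite addr_ge0// mulr_ge0 ?ler0n ?expR_ge0. Qed.

Lemma cmod_weight F a1 a2 k z : 0 < a1 -> 0 < a2 ->
  cmod (pderiv k.1 k.2 F z * rc (weight a1 a2 k)^-1) = wterm F a1 a2 k z.
Proof. by move=> h1 h2; rewrite cmodM cmod_rc ger0_norm// invr_ge0 ltW// weight_gt0. Qed.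

Lemma weight_shift (X y w n a : R) : w != 0 -> n != 0 -> a != 0 ->
  X * y / w = n * (y * a) * (X / (w * (n * a))).
Proof. by move=> w0 n0 a0; field; rewrite w0 n0 a0. Qed.

(* Along a line in a coordinate direction the weighted derivatives of order at
   most N satisfy a closed differential inequality, since those of order N+1
   are bounded by A times their sum. *)
Lemma growth1 F N (a1 a2 b A : R) (u v h : C) : sep_hol F -> 0 < a1 -> 0 < a2 -> 0 <= A -> 0 <= b ->
  cmod h <= b / a1 ->
  (forall t : R, 0 <= t <= 1 -> D2 (u + rc t * h, v)) ->
  (forall t k, 0 <= t <= 1 -> (k.1 + k.2 <= N.+1)%N ->
     wterm F a1 a2 k (u + rc t * h, v) <= A * wsum F N a1 a2 (u + rc t * h, v)) ->
  wsum F N a1 a2 (u + h, v) <= growth_const N b A * wsum F N a1 a2 (u, v).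
Proof.
move=> sF a10 a20 A0 b0 hb inD hA.
pose z t : C * C := (u + rc t * h, v).
pose phi k t : C := pderiv k.1 k.2 F (z t) * rc (weight a1 a2 k)^-1.
pose psi k t : C := pderiv k.1.+1 k.2 F (z t) * h * rc (weight a1 a2 k)^-1.
have Sphi t : \sum_(k <- multi_idx N) cmod (phi k t) = wsum F N a1 a2 (z t).
  by apply: eq_bigr => k _; exact: cmod_weight.
have := @gronwall R _ (multi_idx N) phi psi (N.+1%:R * b * A).
have z1 : z 1 = (u + h, v) by rewrite /z rc1 mul1r.
have z0 : z 0 = (u, v) by rewrite /z rc0 mul0r addr0.
rewrite !Sphi z1 z0 -/(growth_const N b A); apply.
- by rewrite !mulr_ge0.
- move=> k t _ tt; have [hd _ _] := sep_hol_pderiv k.1 k.2 sF (inD t tt).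
  have h1 := has_cdM hd (has_cd_cst (rc (weight a1 a2 k)^-1) (u + rc t * h)).
  have := has_cd_rd (has_rd_line u h t) h1.
  congr has_rd; rewrite mulr0 add0r /psi.
  have -> : pderiv k.1.+1 k.2 F (z t) = pd1 (pderiv k.1 k.2 F) (u + rc t * h, v) by [].
  by rewrite (mulrC (rc _)) mulrAC.
- move=> [i j] t; rewrite mem_multi_idx /= => ij tt; rewrite Sphi.
  have hk := hA t (i.+1, j) tt; rewrite /= addSn ltnS in hk.
  have {}hk := hk ij.
  rewrite /psi /= !cmodM cmod_rc ger0_norm ?invr_ge0 ?(ltW (weight_gt0 _ a10 a20))//.
  have w0 := weight_gt0 (i, j) a10 a20.
  have -> : cmod (pderiv i.+1 j F (z t)) * cmod h / weight a1 a2 (i, j) =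
    i.+1%:R * (cmod h * a1) * wterm F a1 a2 (i.+1, j) (z t).
    rewrite /wterm weightS1; apply: weight_shift; rewrite ?pnatr_eq0 ?gt_eqF//.
  have -> : N.+1%:R * b * A * wsum F N a1 a2 (z t) = (N.+1%:R * b) * (A * wsum F N a1 a2 (z t)) by ring.
  apply: ler_pM; rewrite ?wterm_ge0 ?mulr_ge0 ?cmod_ge0 ?(ltW a10)//.
  apply: ler_pM; rewrite ?mulr_ge0 ?cmod_ge0 ?(ltW a10)//.
    by rewrite ler_nat ltnS (leq_trans (leq_addr j i) ij).
  by rewrite -ler_pdivlMr.
Qed.

(** As in the first variable, except that the new derivative arises outside the others and is
    brought into the order of [pderiv] by [pd2_pderiv]. *)
Lemma growth2 F N (a1 a2 b A : R) (u v h : C) : sep_hol F -> 0 < a1 -> 0 < a2 -> 0 <= A -> 0 <= b ->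
  cmod h <= b / a2 ->
  (forall t : R, 0 <= t <= 1 -> D2 (u, v + rc t * h)) ->
  (forall t k, 0 <= t <= 1 -> (k.1 + k.2 <= N.+1)%N ->
     wterm F a1 a2 k (u, v + rc t * h) <= A * wsum F N a1 a2 (u, v + rc t * h)) ->
  wsum F N a1 a2 (u, v + h) <= growth_const N b A * wsum F N a1 a2 (u, v).
Proof.
move=> sF a10 a20 A0 b0 hb inD hA.
pose z t : C * C := (u, v + rc t * h).
pose phi k t : C := pderiv k.1 k.2 F (z t) * rc (weight a1 a2 k)^-1.
pose psi k t : C := pderiv k.1 k.2.+1 F (z t) * h * rc (weight a1 a2 k)^-1.
have Sphi t : \sum_(k <- multi_idx N) cmod (phi k t) = wsum F N a1 a2 (z t).
  by apply: eq_bigr => k _; exact: cmod_weight.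
have := @gronwall R _ (multi_idx N) phi psi (N.+1%:R * b * A).
have z1 : z 1 = (u, v + h) by rewrite /z rc1 mul1r.
have z0 : z 0 = (u, v) by rewrite /z rc0 mul0r addr0.
rewrite !Sphi z1 z0 -/(growth_const N b A); apply.
- by rewrite !mulr_ge0.
- move=> k t _ tt; have [_ hd _] := sep_hol_pderiv k.1 k.2 sF (inD t tt).
  have h1 := has_cdM hd (has_cd_cst (rc (weight a1 a2 k)^-1) (v + rc t * h)).
  have := has_cd_rd (has_rd_line v h t) h1.
  congr has_rd; rewrite mulr0 add0r /psi.
  rewrite -(pd2_pderiv k.1 k.2 sF (inD t tt)).
  by rewrite (mulrC (rc _)) mulrAC.
- move=> [i j] t; rewrite mem_multi_idx /= => ij tt; rewrite Sphi.
  have hk := hA t (i, j.+1) tt; rewrite /= addnS ltnS in hk.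
  have {}hk := hk ij.
  rewrite /psi /= !cmodM cmod_rc ger0_norm ?invr_ge0 ?(ltW (weight_gt0 _ a10 a20))//.
  have w0 := weight_gt0 (i, j) a10 a20.
  have -> : cmod (pderiv i j.+1 F (z t)) * cmod h / weight a1 a2 (i, j) =
    j.+1%:R * (cmod h * a2) * wterm F a1 a2 (i, j.+1) (z t).
    rewrite /wterm weightS2; apply: weight_shift; rewrite ?pnatr_eq0 ?gt_eqF//.
  have -> : N.+1%:R * b * A * wsum F N a1 a2 (z t) = (N.+1%:R * b) * (A * wsum F N a1 a2 (z t)) by ring.
  apply: ler_pM; rewrite ?wterm_ge0 ?mulr_ge0 ?cmod_ge0 ?(ltW a20)//.
  apply: ler_pM; rewrite ?mulr_ge0 ?cmod_ge0 ?(ltW a20)//.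
    by rewrite ler_nat ltnS (leq_trans (leq_addl i j) ij).
  by rewrite -ler_pdivlMr.
Qed.

End Growth.

(** * Bounded index *)

Section Main.
Variable R : realType.
Local Notation C := (Cc R).
Implicit Types (F : C * C -> C).

(** Positivity of [lambda1] and finiteness of [lambda2], with the inequality between them, make both
    real numbers [m] and [M]; the maximum of [1], [M] and [1 / m] bounds the ratio and its
    inverse. *)
Lemma lambda_bounds (l1 l2 lj : C * C -> R) (r1 r2 : R) : lambda_ok l1 l2 lj r1 r2 ->
  (forall z, D2 z -> 0 < lj z) ->
  exists2 B : R, 1 <= B & forall z0 z, D2 z0 -> D2 z -> in_polydisc l1 l2 z0 r1 r2 z ->
    lj z <= B * lj z0 /\ lj z0 <= B * lj z.
Proof.
move=> [lam0 [lam12 lamoo]] lj0.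
have inS z0 z : D2 z0 -> D2 z -> in_polydisc l1 l2 z0 r1 r2 z ->
    ratio_set l1 l2 lj r1 r2 (lj z / lj z0)%:E by move=> h0 h1 h2; exists z0, z.
have [m mE] : exists m : R, lambda1 l1 l2 lj r1 r2 = m%:E.
  case: (lambda1 l1 l2 lj r1 r2) lam0 lam12 => [m||] //; first by exists m.
  by move=> _ /le_lt_trans /(_ lamoo).
have [M ME] : exists M : R, lambda2 l1 l2 lj r1 r2 = M%:E.
  case: (lambda2 l1 l2 lj r1 r2) lam12 lamoo => [M||] //; first by exists M.
  by rewrite mE.
have m0 : 0 < m by move: lam0; rewrite mE lte_fin.
exists (Num.max 1 (Num.max M m^-1)); first by rewrite le_max lexx.
move=> z0 z h0 h1 h2; have zz := inS _ _ h0 h1 h2.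
have p0 := lj0 _ h0; have p1 := lj0 _ h1.
have a1 : m <= lj z / lj z0 by rewrite -lee_fin -mE; exact: ereal_inf_lbound.
have a2 : lj z / lj z0 <= M by rewrite -lee_fin -ME; exact: ereal_sup_ubound.
split.
  apply: (@le_trans _ _ (M * lj z0)); first by rewrite -ler_pdivrMr.
  by rewrite ler_pM2r// !le_max lexx orbT.
apply: (@le_trans _ _ (m^-1 * lj z)).
  by rewrite mulrC ler_pdivlMr// mulrC -ler_pdivlMr.
by rewrite ler_pM2r// !le_max lexx !orbT.
Qed.

(** Inverts the lower bound on [l_j] into a statement on radii: the closed polydisc of radii
    [beta / l_j] lies in the bidisc. *)
Lemma admissible_gt (beta : R) (l1 l2 : C * C -> R) u v : 0 < beta -> admissible beta l1 l2 -> D2 (u, v) ->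
  [/\ 0 < l1 (u, v), 0 < l2 (u, v), 0 < beta / l1 (u, v) < 1 - cmod u &
      0 < beta / l2 (u, v) < 1 - cmod v].
Proof.
move=> b0 adm uv; have [_ [_ [_ [_ [/= h1 h2]]]]] := adm _ uv; have [/= u1 v1] := uv.
have u0 : 0 < 1 - cmod u by rewrite subr_gt0.
have v0 : 0 < 1 - cmod v by rewrite subr_gt0.
have l10 : 0 < l1 (u, v) by apply: lt_trans h1; exact: divr_gt0.
have l20 : 0 < l2 (u, v) by apply: lt_trans h2; exact: divr_gt0.
split => //; rewrite divr_gt0//= ltr_pdivrMr//.
  by rewrite mulrC -ltr_pdivrMr.
by rewrite mulrC -ltr_pdivrMr.
Qed.

(** A self-improvement: the assumed domination is uniform in [p] and gives no summability, while the
    conclusion has ratio [1 / beta]. *)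
Lemma geometric_decay (beta : R) (l1 l2 : C * C -> R) F (N : nat) (c : R) :
  1 < beta -> Q2 beta l1 l2 -> sep_hol F -> 0 <= c ->
  (forall z, D2 z -> forall p, nterm F l1 l2 p.1 p.2 z <= c * wsum F N (l1 z) (l2 z) z) ->
  exists2 K : R, 0 <= K & forall z, D2 z -> forall p,
    nterm F l1 l2 p.1 p.2 z <= K * beta^-1 ^+ (p.1 + p.2) * wsum F N (l1 z) (l2 z) z.
Proof.
move=> b1 [adm lamok] sF c0 H.
have b0 : 0 < beta by exact: lt_trans b1.
have bb : 0 <= beta <= beta by rewrite ltW//=.
have l10 z : D2 z -> 0 < l1 z by case: z => u v /(admissible_gt b0 adm)[].
have l20 z : D2 z -> 0 < l2 z by case: z => u v /(admissible_gt b0 adm)[].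
have [lam1 lam2] := lamok beta beta bb bb.
have [B1 B11 HB1] := lambda_bounds lam1 l10.
have [B2 B21 HB2] := lambda_bounds lam2 l20.
pose B := Num.max B1 B2.
have B11' : 1 <= B by rewrite le_max B11.
have [BB1 BB2] : B1 <= B /\ B2 <= B by rewrite !le_max !lexx orbT.
have B0 : 0 <= B by exact: le_trans ler01 B11'.
(* A term of order at most [N + 1] passes from frozen to actual weights at cost [B ^+ N.+1], the
   hypothesis costs [c], and the terms of order at most [N] return to frozen weights at cost
   [B ^+ N]. *)
pose A := B ^+ N.+1 * (c * B ^+ N).
have A0 : 0 <= A by rewrite !mulr_ge0// exprn_ge0.
(* The 4 is that of [cauchy_estimate2]; there is one growth constant for each leg of the path from
   [(u, v)] through [(u', v)] to [(u', v')]. *)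
pose K := 4 * (growth_const N beta A * growth_const N beta A).
have g0 := @growth_const_ge0 R N beta A.
exists K; first by rewrite !mulr_ge0.
move=> [u v] uv p; have [L10 L20 r1P r2P] := admissible_gt b0 adm uv.
set L1 := l1 (u, v) in L10 r1P *; set L2 := l2 (u, v) in L20 r2P *.
have /andP[r10 r11] := r1P; have /andP[r20 r21] := r2P.
have inD u' v' : cmod (u' - u) <= beta / L1 -> cmod (v' - v) <= beta / L2 -> D2 (u', v').
  move=> h1 h2; split => /=.
    by rewrite -(subrK u u'); apply: le_lt_trans (cmodD _ _) _; lra.
  by rewrite -(subrK v v'); apply: le_lt_trans (cmodD _ _) _; lra.
have hyp u' v' k : cmod (u' - u) <= beta / L1 -> cmod (v' - v) <= beta / L2 ->
    (k.1 + k.2 <= N.+1)%N -> wterm F L1 L2 k (u', v') <= A * wsum F N L1 L2 (u', v').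
  move=> h1 h2 kN; have D' := inD _ _ h1 h2.
  have inP : in_polydisc l1 l2 (u, v) beta beta (u', v') by [].
  have [x1 x2] := HB1 _ _ uv D' inP; have [y1 y2] := HB2 _ _ uv D' inP.
  have l1p := l10 _ D'; have l2p := l20 _ D'.
  have BM (b t x : R) : b <= B -> 0 < t -> x <= b * t -> x <= B * t.
    by move=> bB t0 xb; apply: le_trans xb _; rewrite ler_pM2r.
  have {}x1 := BM _ _ _ BB1 L10 x1; have {}x2 := BM _ _ _ BB1 l1p x2.
  have {}y1 := BM _ _ _ BB2 L20 y1; have {}y2 := BM _ _ _ BB2 l2p y2.
  have cmp (a1 a2 c1 c2 : R) k' n : 0 < a1 -> 0 < a2 -> 0 < c1 -> 0 < c2 ->
      c1 <= B * a1 -> c2 <= B * a2 -> (k'.1 + k'.2 <= n)%N ->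
      wterm F a1 a2 k' (u', v') <= B ^+ n * wterm F c1 c2 k' (u', v').
    move=> a10 a20 c10 c20 e1 e2 kn; rewrite /wterm ler_pdivrMr ?weight_gt0//.
    have w2 := weight_compare B11' a10 a20 c10 c20 e1 e2 kn.
    have wc := weight_gt0 k' c10 c20.
    set X := cmod _; have -> : B ^+ n * (X / weight c1 c2 k') * weight a1 a2 k' =
      X / weight c1 c2 k' * (B ^+ n * weight a1 a2 k') by ring.
    have X0 : 0 <= X by exact: cmod_ge0.
    apply: (@le_trans _ _ (X / weight c1 c2 k' * weight c1 c2 k')).
      by rewrite divfK// gt_eqF.
    by apply: ler_wpM2l => //; rewrite divr_ge0// ltW.
  apply: le_trans (cmp _ _ _ _ _ _ L10 L20 l1p l2p x1 y1 kN) _.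
  rewrite /A -mulrA; apply: ler_wpM2l; first exact: exprn_ge0.
  apply: le_trans (H _ D' k) _; rewrite -mulrA; apply: ler_wpM2l => //.
  rewrite /wsum mulr_sumr big_seq_cond [leRHS]big_seq_cond; apply: ler_sum => j /andP[].
  by rewrite mem_multi_idx => jN _; apply: cmp.
have mono (t : R) (x : C) (r : R) : 0 <= t <= 1 -> cmod x <= r -> cmod (rc t * x) <= r.
  move=> /andP[t0 t1] xr; rewrite cmodM cmod_rc ger0_norm//.
  by apply: le_trans xr; rewrite ler_piMl ?cmod_ge0.
have Fb u' v' : cmod (u' - u) <= beta / L1 -> cmod (v' - v) <= beta / L2 ->
    cmod (F (u', v')) <= growth_const N beta A * growth_const N beta A * wsum F N L1 L2 (u, v).
  move=> h1 h2.
  have S0 : cmod (F (u', v')) <= wsum F N L1 L2 (u', v').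
    have -> : cmod (F (u', v')) = wterm F L1 L2 (0%N, 0%N) (u', v').
      by rewrite /wterm /weight /= fact0 !expr0 !mulr1 divr1.
    apply: (@le_sum_mem R _ (multi_idx N) (fun k => wterm F L1 L2 k (u', v'))).
      by rewrite mem_multi_idx.
    by move=> j; exact: wterm_ge0.
  apply: le_trans S0 _.
  have b0' := ltW b0.
  have S1 : wsum F N L1 L2 (u', v) <= growth_const N beta A * wsum F N L1 L2 (u, v).
    have -> : u' = u + (u' - u) by rewrite addrC subrK.
    apply: growth1 => //.
      move=> t tt; apply: inD; rewrite ?subrr ?cmod0 ?(ltW r20)//.
      by rewrite addrC addKr; exact: mono.
    move=> t k tt kN; apply: hyp => //; rewrite ?subrr ?cmod0 ?(ltW r20)//.
    by rewrite addrC addKr; exact: mono.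
  have S2 : wsum F N L1 L2 (u', v') <= growth_const N beta A * wsum F N L1 L2 (u', v).
    have -> : v' = v + (v' - v) by rewrite addrC subrK.
    apply: growth2 => //.
      move=> t tt; apply: inD => //.
      by rewrite addrC addKr; exact: mono.
    move=> t k tt kN; apply: hyp => //.
    by rewrite addrC addKr; exact: mono.
  by apply: le_trans S2 _; rewrite -mulrA; exact: ler_wpM2l.
(* With radii [beta / L1] and [beta / L2], the powers of [L1], [L2] and the factorials cancel
   against the normalization, and only [beta^-(p.1 + p.2)] is left. *)
have := cauchy_estimate2 p.1 p.2 sF r1P r2P Fb.
rewrite /nterm -/L1 -/L2.
move: (cmod (pderiv p.1 p.2 F (u, v))) (wsum F N L1 L2 (u, v)) => X S XS.
have P0 : 0 < (p.1`!%:R : R) by rewrite ltr0n fact_gt0.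
have Q0 : 0 < (p.2`!%:R : R) by rewrite ltr0n fact_gt0.
have W0 : 0 < p.1`!%:R * p.2`!%:R * L1 ^+ p.1 * L2 ^+ p.2.
  by rewrite !mulr_gt0 ?exprn_gt0.
rewrite ler_pdivrMr//; apply: le_trans XS _.
rewrite le_eqVlt; apply/orP; left; apply/eqP.
rewrite /K exprD !exprVn !expr_div_n; field.
by rewrite !expf_neq0 ?gt_eqF.
Qed.

Lemma le_wsum F (l1 l2 : C * C -> R) N z i j : 0 < l1 z -> 0 < l2 z -> (i + j <= N)%N ->
  nterm F l1 l2 i j z <= wsum F N (l1 z) (l2 z) z.
Proof.
move=> h1 h2 ij; rewrite nterm_wterm.
apply: (@le_sum_mem R _ (multi_idx N) (fun k => wterm F (l1 z) (l2 z) k z)).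
  by rewrite mem_multi_idx.
by move=> k; exact: wterm_ge0.
Qed.

Lemma bounded_index_sum (beta : R) (l1 l2 : C * C -> R) F : 1 < beta -> Q2 beta l1 l2 ->
  sep_hol F -> bounded_L_index F l1 l2 ->
  exists c : R, 0 < c /\ exists N : nat, (0 < N)%N /\
     forall z, D2 z ->
       (c%:E * (\esum_(k in [set k : nat * nat | (N < k.1 + k.2)%N])
                  (nterm F l1 l2 k.1 k.2 z)%:E)
        <= (\sum_(k1 < N.+1) \sum_(k2 < N.+1 | (k1 + k2 <= N)%N)
               nterm F l1 l2 k1 k2 z)%:E)%E.
Proof.
move=> b1 q2 sF [n0 Hn0].
have b0 : 0 < beta by exact: lt_trans b1.
have l12 z : D2 z -> 0 < l1 z /\ 0 < l2 z.
  by case: z => u v /(admissible_gt b0 q2.1)[].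
(* [n0.+1] rather than [n0], since [N] has to be positive; a nonnegative sum dominates the maximum
   of fewer of its terms. *)
have H z : D2 z -> forall p, nterm F l1 l2 p.1 p.2 z <= 1 * wsum F n0.+1 (l1 z) (l2 z) z.
  move=> Dz p; have [l1p l2p] := l12 _ Dz; rewrite mul1r.
  apply: le_trans (Hn0 z Dz p.1 p.2) _; apply: (@triangle_max_le R n0 (fun i j => nterm F l1 l2 i j z)); first exact: wsum_ge0.
  by move=> i j ij; apply: le_wsum => //; exact: leqW.
have [K K0 HK] := geometric_decay b1 q2 sF ler01 H.
pose q := beta^-1.
have q01 : 0 <= q < 1 by rewrite invr_ge0 ltW//= invf_lt1.
have q1 : 0 < 1 - q by rewrite subr_gt0; case/andP: q01.
(* The double geometric series over all multi-indices bounds the tail; the [+ 1] keeps [D] positive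
   when [K = 0]. *)
pose D := K / (1 - q) / (1 - q) + 1.
have D0 : 0 < D by rewrite ltr_wpDl// !divr_ge0// ltW.
exists D^-1; split; first by rewrite invr_gt0.
exists n0.+1; split => // z Dz; have [l1p l2p] := l12 _ Dz.
have S0 := wsum_ge0 F n0.+1 z l1p l2p.
rewrite (sum_multi_idx n0.+1 (fun i j => nterm F l1 l2 i j z)).
rewrite -/(wsum F n0.+1 (l1 z) (l2 z) z).
set S := wsum _ _ _ _ _ in S0 *.
have KS0 : 0 <= K * S by rewrite mulr_ge0.
have E1 : (\esum_(k in [set k : nat * nat | (n0.+1 < k.1 + k.2)%N])
      (nterm F l1 l2 k.1 k.2 z)%:E <= (K * S / (1 - q) / (1 - q))%:E)%E.
  apply: le_trans (geometric_esum2 KS0 q01).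
  apply: esum_subset_le => k.
    by rewrite mulr_ge0// exprn_ge0//; case/andP: q01.
  by move=> _; rewrite mulrAC; exact: HK.
apply: (@le_trans _ _ ((D^-1)%:E * (K * S / (1 - q) / (1 - q))%:E)%E).
  by apply: lee_wpmul2l E1; rewrite lee_fin invr_ge0 ltW.
rewrite -EFinM lee_fin mulrC ler_pdivrMr// /D mulrDr mulr1.
have -> : K * S / (1 - q) / (1 - q) = S * (K / (1 - q) / (1 - q)) by ring.
by rewrite lerDl.
Qed.

(** Each single term is at most [1 + 1 / c] times the sum up to [N]: orders at most [N] occur in
    that sum, and a higher order is one term of the series. The decay then makes high orders smaller
    than the maximum over low ones. *)
Lemma sum_bounded_index (beta : R) (l1 l2 : C * C -> R) F (c : R) (N : nat) :
  1 < beta -> Q2 beta l1 l2 -> sep_hol F -> 0 < c ->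
  (forall z, D2 z ->
       (c%:E * (\esum_(k in [set k : nat * nat | (N < k.1 + k.2)%N])
                  (nterm F l1 l2 k.1 k.2 z)%:E)
        <= (\sum_(k1 < N.+1) \sum_(k2 < N.+1 | (k1 + k2 <= N)%N)
               nterm F l1 l2 k1 k2 z)%:E)%E) ->
  bounded_L_index F l1 l2.
Proof.
move=> b1 q2 sF c0 Hc.
have b0 : 0 < beta by exact: lt_trans b1.
have l12 z : D2 z -> 0 < l1 z /\ 0 < l2 z.
  by case: z => u v /(admissible_gt b0 q2.1)[].
have c10 : 0 <= 1 + c^-1 by rewrite addr_ge0// invr_ge0 ltW.
have H z : D2 z -> forall p, nterm F l1 l2 p.1 p.2 z <= (1 + c^-1) * wsum F N (l1 z) (l2 z) z.
  move=> Dz p; have [l1p l2p] := l12 _ Dz.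
  have S0 := wsum_ge0 F N z l1p l2p.
  have := Hc z Dz; rewrite (sum_multi_idx N (fun i j => nterm F l1 l2 i j z)).
  rewrite -/(wsum F N (l1 z) (l2 z) z).
  have [pN _|Np] := leqP (p.1 + p.2) N.
    apply: le_trans (le_wsum F l1p l2p pN) _.
    by rewrite ler_peMl// lerDl invr_ge0 ltW.
  set S := wsum _ _ _ _ _ in S0 *.
  set T := esum _ _.
  have pT : ((nterm F l1 l2 p.1 p.2 z)%:E <= T)%E.
    apply: esum_ge; exists [set p].
      by split; [exact: finite_set1|move=> _ ->].
    by rewrite fsbig_set1.
  move=> cT; have : (c%:E * (nterm F l1 l2 p.1 p.2 z)%:E <= S%:E)%E.
    by apply: le_trans cT; apply: lee_wpmul2l pT; rewrite lee_fin ltW.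
  rewrite -EFinM lee_fin mulrC -ler_pdivlMr// => h; apply: le_trans h _.
  by rewrite mulrDl mul1r (mulrC S) lerDr.
have [K K0 HK] := geometric_decay b1 q2 sF c10 H.
pose n : R := (size (multi_idx N))%:R.
have n0 : 0 <= n by exact: ler0n.
have K1 : 0 < K * n + 1 by rewrite ltr_wpDl// mulr_ge0.
pose q := beta^-1.
have q01 : 0 <= q < 1 by rewrite invr_ge0 ltW//= invf_lt1.
have /andP[q0 q1] := q01.
(* Beyond order [m] the decay outweighs both [K] and the number [n] of terms in the sum, which is
   how much the sum may exceed the maximum. *)
have [m Hm] : exists m, (K * n + 1) * q ^+ m <= 1.
  have qn : `|q| < 1 by rewrite ger0_norm.
  have /cvgrPdist_le /(_ (K * n + 1)^-1) := cvg_expr qn.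
  rewrite invr_gt0 => /(_ K1)[m _ Hm]; exists m.
  have := Hm m (leqnn m); rewrite /= sub0r normrN ger0_norm ?exprn_ge0// => h.
  by rewrite mulrC -ler_pdivlMr// div1r.
(* At least [N], so that every term of the sum enters the maximum; at least [m], so that all
   remaining orders have enough decay. *)
exists (maxn m N) => z Dz p1 p2; have [l1p l2p] := l12 _ Dz.
rewrite -/(triangle_max (maxn m N) (fun i j => nterm F l1 l2 i j z)).
have d0 := triangle_max_ge0 (maxn m N) (fun i j => nterm F l1 l2 i j z).
have [pm|mp] := leqP (p1 + p2) (maxn m N).
  exact: (@le_triangle_max R (maxn m N) (fun i j => nterm F l1 l2 i j z)).
have Sd : wsum F N (l1 z) (l2 z) z <= n * triangle_max (maxn m N) (fun i j => nterm F l1 l2 i j z).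
  set d := triangle_max _ _.
  have -> : n * d = \sum_(k <- multi_idx N) d.
    by rewrite big_const_seq count_predT iter_addr_0 mulr_natl.
  rewrite /wsum big_seq_cond [leRHS]big_seq_cond; apply: ler_sum => k /andP[].
  rewrite mem_multi_idx => kN _; apply: (@le_triangle_max R (maxn m N) (fun i j => nterm F l1 l2 i j z)).
  by rewrite leq_max kN orbT.
move: (triangle_max _ _) d0 Sd => d d0 Sd.
have := HK z Dz (p1, p2); rewrite -/q => /le_trans; apply.
have qm : q ^+ (p1 + p2) <= q ^+ m.
  apply: ler_wiXn2l => //; first exact: ltW.
  by apply: leq_trans (ltnW mp); rewrite leq_max leqnn.
apply: (@le_trans _ _ (K * q ^+ m * (n * d))).
  apply: ler_pM => //; first by rewrite mulr_ge0// exprn_ge0.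
    exact: wsum_ge0.
  exact: ler_wpM2l.
have -> : K * q ^+ m * (n * d) = K * n * q ^+ m * d by ring.
rewrite ler_piMl//; apply: le_trans Hm; rewrite ler_wpM2r ?exprn_ge0//.
by rewrite lerDl.
Qed.

End Main.

Unset Implicit Arguments.
Set Strict Implicit.

Theorem theorem7 (R : realType) (beta : R) (l1 l2 : Cc R * Cc R -> R)
    (F : Cc R * Cc R -> Cc R) :
  1 < beta -> Q2 beta l1 l2 -> analytic_D2 F ->
  (bounded_L_index F l1 l2 <->
   exists c : R, 0 < c /\ exists N : nat, (0 < N)%N /\
     forall z, D2 z ->
       (c%:E * (\esum_(k in [set k : nat * nat | (N < k.1 + k.2)%N])
                  (nterm F l1 l2 k.1 k.2 z)%:E)
        <= (\sum_(k1 < N.+1) \sum_(k2 < N.+1 | (k1 + k2 <= N)%N)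
               nterm F l1 l2 k1 k2 z)%:E)%E).
Proof.
move=> b1 q2 /analytic_sep_hol sF; split; first exact: bounded_index_sum b1 q2 sF.
by move=> [c [c0 [N [_ Hc]]]]; exact: sum_bounded_index b1 q2 sF c0 Hc.
Qed.
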